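(* Consider the composite finite-sum problem and the single-loop variance-reduced acceleration algorithm (the ''Algorithm'') described in the context, with the parameter choices listed there ($\tau_t=1/\alpha_t$ for $t\in\mathbb{N}^+$, $\xi=1/(bc)$, $\tilde\alpha_0\ge\xi\alpha_1^2$, step size $\eta\le1/(cL+L)$), and let $\epsilon\in(0,1)$ be the target accuracy. Define $\hat\alpha=\max\left\{\frac{\log2}{\log(\lceil1/\epsilon\rceil)},\frac{\log2}{\log n}\right\}$. For prefixed constants $C_1,C_2\in[1,+\infty)$ define $$\Delta_1=\frac{1-\frac{\log n}{\log(1/\epsilon)}-2\frac{\log C_1}{\log(1/\epsilon)}}{1+\frac{\log n}{\log(1/\epsilon)}+2\frac{\log C_1}{\log(1/\epsilon)}},\qquad \Delta_2=\frac{1-\frac{\log n}{\log(1/\epsilon)}+2\frac{\log C_2}{\log(1/\epsilon)}}{1+\frac{\log n}{\log(1/\epsilon)}-2\frac{\log C_2}{\log(1/\epsilon)}},$$ where it is required that the choice of $C_2$ makes $\Delta_2$ strictly positive (when $n<1/\epsilon$ this can always be satisfied by choosing $C_2$ sufficiently close to $1$). (i) When $n<1/\epsilon$, by choosing $b=1$ and $\alpha\in[0,1]$ satisfying $$\alpha\in\begin{cases}\left[\max\{0,\Delta_1\},\Delta_2\right] & \text{if }\Delta_2\le\min\{\hat\alpha,1/10\},\\ \left[\max\{\min\{\hat\alpha,1/10\},\Delta_1\},\min\{1,\Delta_2\}\right] & \text{if }\Delta_2>\min\{\hat\alpha,1/10\},\end{cases}$$ the IFO complexity in expectation of the Algorithm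 is $\widetilde{\mathcal{O}}(n+\sqrt n/\sqrt\epsilon)$. (ii) When $n<1/\epsilon$ does not hold, by choosing $b=1$ and $\alpha=0$, the IFO complexity of the Algorithm is $\widetilde{\mathcal{O}}(n)$. Hence the Algorithm achieves near-optimal complexity in both cases under the restricted $b=1$ setting.
   Context: Problem. $\min_{x\in\mathbb{R}^d}F(x):=f(x)+l(x)$ with $f(x)=\frac1n\sum_{i=1}^n f_i(x)$, $n\in\mathbb{N}^+$. Standing assumptions: (A1) the problem has at least one solution, and $x^*$ denotes one fixed solution; (A2) the functions $f_i:\mathbb{R}^d\to\mathbb{R}$ are $L$-smooth for some $L>0$: $f_i(y)\le f_i(x)+\langle\nabla f_i(x),y-x\rangle+\frac L2\|y-x\|^2$ for all $x,y\in\mathbb{R}^d$; (A3) the functions $f_i$ are convex: $f_i(y)\ge f_i(x)+\langle\nabla f_i(x),y-x\rangle$ for all $x,y\in\mathbb{R}^d$; (A4) $l$ is convex and lower semicontinuous (but possibly non-differentiable) and admits an efficient proximal operator. $\|\cdot\|$ is the Euclidean norm, $[n]=\{1,\dots,n\}$, $\mathbb{N}$ is the set of non-negative integers, $\mathbb{N}^+$ the set of positive integers. Algorithm. Initial point $w_1=x_1=y_1=z_1$. For $t=1,2,\dots$: - $x_{t+1}=\tau_t z_t+\xi w_t+(1-\xi-\tau_t)y_t$; - pick $J_t\subset[n]$ according to the uniform distribution on the set of all subsets of $[n]$ of cardinality $b$; - $\tilde g_{t+1}=\frac1b\sum_{j\in J_t}\left(\nabla f_j(x_{t+1})-\nabla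 f_j(w_t)\right)+\nabla f(w_t)$; - $z_{t+1}=\arg\min_{z\in\mathbb{R}^d}\left\{\frac{1}{2\alpha_t\eta}\|z-z_t\|^2+\langle\tilde g_{t+1},z\rangle+l(z)\right\}$; - $y_{t+1}=x_{t+1}+\tau_t(z_{t+1}-z_t)$; - $w_{t+1}=y_t$ with probability $p_t$ and $w_{t+1}=w_t$ with probability $1-p_t$, where $$p_t=\frac{\alpha_{t-1}^2-\alpha_t^2+\alpha_t+\xi\alpha_t^2}{\tilde\alpha_0+\alpha_0^2-\alpha_t^2+\sum_{j=1}^t\alpha_j}.$$ Parameters. For $\alpha\in[0,1]$: $\alpha_t=6$ for $0\le t\le 16$ and $\alpha_t=a_\alpha t^\alpha$ for $t\ge17$, where $a_\alpha=6$ if $\alpha=0$; $a_\alpha=1+\frac{\sqrt2}{4}$ if $\alpha\in(0,1/2]$; $a_\alpha=\frac13$ if $\alpha\in(1/2,3/4]$; $a_\alpha=\frac14\left(\frac{17}{16}\right)^{\alpha-1}$ if $\alpha\in(3/4,1]$. Further, for mini-batch size $b\in[n]$, $c=\max\{2,\,b^{-1}\max\{6/5,(1-\alpha_{17}^{-1})^{-1}\}\}+1$. Cost model. In the incremental first-order oracle (IFO) framework, sampling an index $i$ and computing the pair $(f_i(x),\nabla f_i(x))$ costs one unit (one IFO call). A full gradient is computed at the checkpoint $w_{t+1}$ when the checkpoint is replaced, so the Algorithm makes $\mathcal{O}(b+np_t)$ IFO calls in expectation in iteration $t$. A point $x$ is an $\epsilon$-accurate solution iff $\mathbb{E}[F(x)-F(x^*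 )]\le\epsilon$. The IFO complexity is the minimum number of IFO calls needed to reach an $\epsilon$-accurate solution; the sequence considered is the checkpoint sequence $\{w_t\}$. The notation $\widetilde{\mathcal{O}}$ hides logarithmic factors. ''Near-optimal'' means matching the known lower bound $\Omega(n+\sqrt n/\sqrt\epsilon)$ up to a logarithmic factor. *)

(* Defs.v *)
From HB Require Import structures.
From mathcomp Require Import all_boot all_order all_algebra.
From mathcomp Require Import all_classical all_reals all_analysis.
Import Order.TTheory GRing.Theory Num.Theory.
Import numFieldNormedType.Exports.

Set Implicit Arguments.
Unset Strict Implicit.
Unset Printing Implicit Defensive.

Local Open Scope classical_set_scope.
Local Open Scope ring_scope.

Section Euclidean.
Context {R : realType} {d : nat}.
Implicit Types (u v x y : 'rV[R]_d) (h : 'rV[R]_d -> R) (phi : 'rV[R]_d -> \bar R).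

Definition dotp u v : R := \sum_(i < d) u ord0 i * v ord0 i.

(* The library norm `|u| on row vectors is the sup norm, hence this one. *)
Definition enorm u : R := Num.sqrt (dotp u u).

Definition grad h x : 'rV[R]_d := \row_(i < d) 'D_(delta_mx ord0 i) h x.

Definition smooth (L : R) h :=
  (forall x, differentiable h x) /\
  forall x y, h y <= h x + dotp (grad h x) (y - x) + L / 2 * enorm (y - x) ^+ 2.

Definition convex_diff h :=
  forall x y, h x + dotp (grad h x) (y - x) <= h y.

Definition is_argmin phi x := forall u, (phi x <= phi u)%E.

(* Some minimizer of phi; the arbitrary value 0 if there is none. *)
Definition argmin phi : 'rV[R]_d := xget 0 [set x | is_argmin phi x].

Definition proper phi :=
  (forall x, (-oo < phi x)%E) /\ exists x, (phi x < +oo)%E.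

(* Products follow the convention 0 * +oo = 0, so t = 0, 1 are harmless. *)
Definition convex_ereal phi := forall x y (t : R), 0 <= t <= 1 ->
  (phi (t *: x + (1 - t) *: y)%R <= t%:E * phi x + (1 - t)%:E * phi y)%E.

Definition admits_prox phi := forall (lambda : R) v, 0 < lambda ->
  exists x, is_argmin
    (fun u => phi u + ((2 * lambda)^-1 * enorm (u - v) ^+ 2)%:E)%E x.

End Euclidean.

(* The regularizer may take the value +oo (e.g. indicators of convex sets);
   real-valued regularizers are a special case. *)
Record problem (R : realType) := Problem {
  dim : nat;
  nfun : nat;
  fi : 'I_nfun -> 'rV[R]_dim -> R;
  reg : 'rV[R]_dim -> \bar R }.

Section Problem.
Context {R : realType}.
Variable P : problem R.

Definition favg (x : 'rV[R]_(dim P)) : R :=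
  (nfun P)%:R^-1 * \sum_(i < nfun P) fi i x.

Definition objective (x : 'rV[R]_(dim P)) : \bar R :=
  ((favg x)%:E + reg x)%E.

Record standing (L : R) (xstar : 'rV[R]_(dim P)) : Prop := Standing {
  nfun_gt0 : (0 < nfun P)%N;
  xstar_sol : is_argmin objective xstar;
  L_gt0 : 0 < L;
  fi_smooth : forall i : 'I_(nfun P), smooth L (fi i);
  fi_convex : forall i : 'I_(nfun P), convex_diff (fi i);
  reg_proper : proper (@reg R P);
  reg_convex : convex_ereal (@reg R P);
  reg_lsc : lower_semicontinuous (@reg R P);
  reg_prox : admits_prox (@reg R P) }.

End Problem.

Section ParameterChoice.
Context {R : realType}.
Variables (alpha : R) (b : nat) (talpha0 : R).

Definition a_coef : R :=
  if alpha == 0 then 6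
  else if alpha <= 1 / 2 then 1 + Num.sqrt 2 / 4
  else if alpha <= 3 / 4 then 1 / 3
  else 1 / 4 * (17 / 16) `^ (alpha - 1).

Definition alpha_ (t : nat) : R :=
  if (t <= 16)%N then 6 else a_coef * t%:R `^ alpha.

Definition tau_ (t : nat) : R := 1 / alpha_ t.

Definition c_par : R :=
  Num.max 2 (b%:R^-1 * Num.max (6 / 5) (1 - (alpha_ 17)^-1)^-1) + 1.

Definition xi : R := 1 / (b%:R * c_par).

Definition p_ (t : nat) : R :=
  (alpha_ t.-1 ^+ 2 - alpha_ t ^+ 2 + alpha_ t + xi * alpha_ t ^+ 2) /
  (talpha0 + alpha_ 0 ^+ 2 - alpha_ t ^+ 2 + \sum_(1 <= j < t.+1) alpha_ j).

End ParameterChoice.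

(* An execution setup: problem, its fixed solution, initial point, algorithm
   parameters and target accuracy. *)
Record setup (R : realType) := Setup {
  pb : problem R;
  xstar : 'rV[R]_(dim pb);
  init : 'rV[R]_(dim pb);
  batch : nat;
  alpha : R;
  talpha0 : R;
  eta : R;
  eps : R }.

Section Algorithm.
Context {R : realType}.
Variable S : setup R.

Let d := dim (pb S).
Let n := nfun (pb S).
Let b := batch S.
Let f := @favg R (pb S).
Let l := @reg R (pb S).
Let al (t : nat) := alpha_ (alpha S) t.
Let tau (t : nat) := tau_ (alpha S) t.
Let x_i := xi (alpha S) b.
Let p (t : nat) := p_ (alpha S) b (talpha0 S) t.

Record state := State {
  st_x : 'rV[R]_d; st_y : 'rV[R]_d; st_z : 'rV[R]_d; st_w : 'rV[R]_d }.

Definition init_state := State (init S) (init S) (init S) (init S).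

(* The randomness of one iteration: the mini-batch J_t, and whether the
   checkpoint is replaced. *)
Definition draw := ({set 'I_n} * bool)%type.

Definition step (t : nat) (s : state) (J : draw) : state :=
  let: State _ y z w := s in
  let x' := tau t *: z + x_i *: w + (1 - x_i - tau t) *: y in
  let g := b%:R^-1 *: (\sum_(j in J.1) (grad (@fi R (pb S) j) x' - grad (@fi R (pb S) j) w))
           + grad f w in
  let z' := argmin (fun u =>
    ((1 / (2 * al t * eta S) * enorm (u - z) ^+ 2 + dotp g u)%:E + l u)%E) in
  let y' := x' + tau t *: (z' - z) in
  let w' := if J.2 then y else w in
  State x' y' z' w'.

(* [run t s h] executes iterations t, t+1, ..., t + size h - 1 from state s
   with successive draws h. *)
Fixpoint run (t : nat) (s : state) (h : seq draw) : state :=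
  if h is J :: h' then run t.+1 (step t s J) h' else s.

(* Joint law of the (independent) draws of iterations t, t+1, ... *)
Definition law_draw (t : nat) (J : draw) : R :=
  (if #|J.1| == b then ('C(n, b))%:R^-1 else 0) *
  (if J.2 then p t else 1 - p t).

Fixpoint law (t : nat) (h : seq draw) : R :=
  if h is J :: h' then law_draw t J * law t.+1 h' else 1.

(* Expectation of a function of the draws of iterations 1, ..., T. *)
Definition expect (T : nat) (X : seq draw -> \bar R) : \bar R :=
  (\sum_(h : T.-tuple draw) (law 1 h)%:E * X h)%E.

(* The checkpoint w_{T+1} reached after the T = size h first iterations. *)
Definition checkpoint (h : seq draw) := st_w (run 1 init_state h).

(* Oracle calls used to obtain w_{T+1}: n for the full gradient at w_1; in each
   iteration two per index of J_t (points x_{t+1} and w_t), plus n if the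
   checkpoint is replaced. *)
Definition ifo_calls (h : seq draw) : nat :=
  (n + \sum_(J <- h) (2 * #|J.1| + (if J.2 then n else 0)))%N.

Definition accurate (T : nat) :=
  (expect T (fun h => objective (checkpoint h) - objective (xstar S)) <= (eps S)%:E)%E.

(* Equals +oo if no checkpoint is accurate. *)
Definition ifo_complexity : \bar R :=
  ereal_inf [set expect T (fun h => (ifo_calls h)%:R%:E) | T in [set T | accurate T]].

(* Everything the constants hidden in the complexity bounds may depend on is
   bounded uniformly over the family: smoothness constant, initial distance and
   initial gap, and the freely chosen parameters eta and talpha0.  The family
   ranges over all n, eps, dimensions, problems, and all b and alpha. *)
Definition admissible (L eta_min talpha_max D gap : R) : Prop :=
  [/\ standing L (xstar S),
      (1 <= b <= n)%N /\ 0 <= alpha S <= 1,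
      x_i * al 1 ^+ 2 <= talpha0 S <= talpha_max,
      eta_min <= eta S <= 1 / (c_par (alpha S) b * L + L) &
      [/\ 0 < eps S < 1, enorm (init S - xstar S) <= D &
          (objective (init S) - objective (xstar S) <= gap%:E)%E]].

End Algorithm.

Section Range.
Context {R : realType}.
Variables (n : nat) (e : R).

(* Extended-real division: ln 2 / ln 1 = +oo when n = 1. *)
Definition alpha_hat : \bar R :=
  Order.max ((ln 2)%:E / (ln (Num.ceil (1 / e))%:~R)%:E)%E
            ((ln 2)%:E / (ln n%:R)%:E)%E.

Definition alpha_cut : \bar R := Order.min alpha_hat (1 / 10)%:E.

Definition Delta1 (C1 : R) : R :=
  (1 - ln n%:R / ln (1 / e) - 2 * (ln C1 / ln (1 / e))) /
  (1 + ln n%:R / ln (1 / e) + 2 * (ln C1 / ln (1 / e))).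

Definition Delta2 (C2 : R) : R :=
  (1 - ln n%:R / ln (1 / e) + 2 * (ln C2 / ln (1 / e))) /
  (1 + ln n%:R / ln (1 / e) - 2 * (ln C2 / ln (1 / e))).

Definition alpha_range (C1 C2 a : R) : Prop :=
  0 <= a <= 1 /\
  if ((Delta2 C2)%:E <= alpha_cut)%E
  then Num.max 0 (Delta1 C1) <= a <= Delta2 C2
  else (Order.max alpha_cut (Delta1 C1)%:E <= a%:E)%E &&
       (a <= Num.min 1 (Delta2 C2)).

End Range.

Section Asymptotics.
Context {R : realType}.

(* u = O(g (log g)^k) on D for some k; used below only with g >= 2. *)
Definition tildeO (I : Type) (D : set I) (u : I -> \bar R) (g : I -> R) : Prop :=
  exists (C : R) (k : nat), forall i, D i -> (u i <= (C * (g i * ln (g i) ^+ k))%:E)%E.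

Definition lower_bound (S : setup R) : R :=
  (nfun (pb S))%:R + Num.sqrt (nfun (pb S))%:R / Num.sqrt (eps S).

(* The complexity matches the known Omega(n + sqrt n / sqrt eps) up to a single
   logarithmic factor. *)
Definition near_optimal (D : set (setup R)) : Prop :=
  exists C : R, forall S, D S ->
    (ifo_complexity S <= (C * (lower_bound S * ln (lower_bound S)))%:E)%E.

Definition case_i (C1 C2 : R) (S : setup R) : Prop :=
  [/\ (nfun (pb S))%:R < 1 / eps S, batch S = 1%N,
      0 < Delta2 (nfun (pb S)) (eps S) C2 &
      alpha_range (nfun (pb S)) (eps S) C1 C2 (alpha S)].

Definition case_ii (S : setup R) : Prop :=
  [/\ ~ (nfun (pb S))%:R < 1 / eps S, batch S = 1%N & alpha S = 0].

End Asymptotics.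

(* Main.v *)
Require Import Defs.
From HB Require Import structures.
From mathcomp Require Import all_boot all_order all_algebra.
From mathcomp Require Import all_classical all_reals all_analysis.
From mathcomp Require Import ring lra.
Import Order.TTheory GRing.Theory Num.Theory.
Import numFieldNormedType.Exports.
Local Open Scope classical_set_scope.
Local Open Scope ring_scope.

Set Implicit Arguments.
Unset Strict Implicit.
Unset Printing Implicit Defensive.

(** Write [Q_t] for the denominator of [p_t] (with [Q_0 = talpha0]) and [gap] for
    [F - F(u)], where [u] is the solution.  Since
    [p_t Q_t = Q_t - Q_(t-1) + xi alpha_t^2], the potential
    [Q_(t-1) gap(w_t) + alpha_(t-1)^2 gap(y_t) + |u - z_t|^2 / (2 eta)] does not
    increase in expectation: this combines smoothness along [y_(t+1) - x_(t+1)],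
    the prox inequality at [u], and the variance bound
    [2 L (f(w) - f(x) - <grad f(x), w - x>)], whose coefficient [1 / (2 c L)]
    produces exactly the weight [xi] of the checkpoint.  Hence
    [E gap(w_(T+1)) = O(1 / Q_T) = O(T^-(1 + alpha))] and
    [T ~ (1/eps)^(1/(1 + alpha))] iterations suffice.  As [p_t = O(t^(alpha - 1))],
    they cost [O(n + T + n T^alpha log T)] oracle calls.  The conditions
    [Delta1 <= alpha] and [alpha <= Delta2] say precisely that [T] and
    [n T^alpha] are at most a constant times [sqrt n / sqrt eps]. *)

(** * Smooth convex functions and proximal steps *)

Section DotProduct.
Context {R : realType} {d : nat}.
Implicit Types (u v w : 'rV[R]_d) (k : R).

Lemma dotpC u v : dotp u v = dotp v u.
Proof. by apply: eq_bigr => i _; rewrite mulrC. Qed.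

Lemma dotpDl u v w : dotp (u + v) w = dotp u w + dotp v w.
Proof. by rewrite -big_split /=; apply: eq_bigr => i _; rewrite mxE mulrDl. Qed.

Lemma dotpZl k u v : dotp (k *: u) v = k * dotp u v.
Proof. by rewrite mulr_sumr; apply: eq_bigr => i _; rewrite mxE mulrA. Qed.

Lemma dotpNl u v : dotp (- u) v = - dotp u v.
Proof. by rewrite -scaleN1r dotpZl mulN1r. Qed.

Lemma dotpDr u v w : dotp u (v + w) = dotp u v + dotp u w.
Proof. by rewrite dotpC dotpDl 2!(dotpC u). Qed.

Lemma dotpZr k u v : dotp u (k *: v) = k * dotp u v.
Proof. by rewrite dotpC dotpZl dotpC. Qed.

Lemma dotpNr u v : dotp u (- v) = - dotp u v.
Proof. by rewrite dotpC dotpNl dotpC. Qed.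

Lemma dotp_suml (I : finType) (F : I -> 'rV[R]_d) v :
  dotp (\sum_i F i) v = \sum_i dotp (F i) v.
Proof.
apply: (big_ind2 (fun a b => dotp a v = b)) => //.
  by apply: big1 => i _; rewrite mxE mul0r.
by move=> ? ? ? ? <- <-; rewrite dotpDl.
Qed.

Lemma dotp_ge0 u : 0 <= dotp u u.
Proof. by apply: sumr_ge0 => i _; rewrite -expr2 sqr_ge0. Qed.

Lemma sqr_enorm u : enorm u ^+ 2 = dotp u u.
Proof. by rewrite sqr_sqrtr// dotp_ge0. Qed.

Lemma sqr_enormB u v :
  enorm (u - v) ^+ 2 = enorm u ^+ 2 + (- 2 * dotp u v + dotp v v).
Proof.
rewrite !sqr_enorm dotpDl !dotpDr !dotpNl !dotpNr (dotpC v u).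
by move: (dotp u u) (dotp u v) (dotp v v) => p q r; ring.
Qed.

End DotProduct.

Definition dotpE := (@dotpDl, @dotpDr, @dotpNl, @dotpNr, @dotpZl, @dotpZr).

(** * Gradient differences of smooth convex functions; convex combinations of three points *)

Section SmoothConvex.
Context {R : realType} {d : nat}.
Implicit Types (h : 'rV[R]_d -> R) (x w z : 'rV[R]_d).

(* Compare both bounds on [h] at the gradient step [w - L^-1 (grad h w - grad h x)]. *)
Lemma smooth_convex_gradient_gap (L : R) h x w :
  0 < L -> smooth L h -> convex_diff h ->
  enorm (grad h w - grad h x) ^+ 2
    <= 2 * L * (h w - h x - dotp (grad h x) (w - x)).
Proof.
move=> L0 [_ hs] hc; set D := grad h w - grad h x.
have := le_trans (hc x (w - L^-1 *: D)) (hs w _).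
have -> : w - L^-1 *: D - w = - (L^-1 *: D) by rewrite addrAC subrr add0r.
rewrite !sqr_enorm.
have -> : w - L^-1 *: D - x = (w - x) - L^-1 *: D by rewrite addrAC.
have E : dotp (grad h w) D = dotp (grad h x) D + dotp D D.
  by rewrite -dotpDl addrCA subrr addr0.
rewrite (dotpDr (grad h x)) !(dotpNl, dotpNr, dotpZl, dotpZr) E opprK => H.
have L0' : L != 0 by rewrite gt_eqF.
rewrite -subr_ge0; rewrite -subr_ge0 in H.
have -> : 2 * L * (h w - h x - dotp (grad h x) (w - x)) - dotp D D =
  2 * L * (h w - L^-1 * (dotp (grad h x) D + dotp D D) +
    L / 2 * (L^-1 * (L^-1 * dotp D D)) -
    (h x + (dotp (grad h x) (w - x) - L^-1 * dotp (grad h x) D))) by field.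
by rewrite mulr_ge0// mulr_ge0// ltW.
Qed.

(** Two nested binary inequalities: [y] and [z] are merged with weights [q / (q + r)] and
    [r / (q + r)], and the result is joined with [x]. Positivity of [q] makes [q + r] invertible; in
    the applications [q] is the checkpoint weight [xi]. *)
Lemma convex_comb3 (phi : 'rV[R]_d -> \bar R) (x y z : 'rV[R]_d) (p q r : R) :
  (forall v, (-oo < phi v)%E) -> convex_ereal phi ->
  0 <= p -> 0 < q -> 0 <= r -> p + q + r = 1 ->
  (phi x < +oo)%E -> (phi y < +oo)%E -> (phi z < +oo)%E ->
  (phi (p *: x + q *: y + r *: z)%R < +oo)%E /\
  fine (phi (p *: x + q *: y + r *: z)) <=
    p * fine (phi x) + q * fine (phi y) + r * fine (phi z).
Proof.
move=> lb cvx p0 q0 r0 pqr xoo yoo zoo.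
have fin v : (phi v < +oo)%E -> phi v = (fine (phi v))%:E.
  by move=> voo; rewrite fineK// fin_real// lb voo.
set s := q + r; have s0 : 0 < s by rewrite /s; lra.
have s0' : s != 0 by rewrite gt_eqF.
set v := (q / s) *: y + (1 - q / s) *: z.
have H1 : 0 <= q / s <= 1.
  by rewrite divr_ge0 ?(ltW s0) ?(ltW q0)// ler_pdivrMr// mul1r /s; lra.
have := cvx y z _ H1; rewrite -/v (fin y)// (fin z)// -!EFinM -EFinD => Hv.
have voo : (phi v < +oo)%E by apply: le_lt_trans Hv _; rewrite ltry.
have H2 : 0 <= p <= 1 by lra.
have -> : p *: x + q *: y + r *: z = p *: x + (1 - p) *: v.
  have -> : 1 - p = s by rewrite /s; lra.
  rewrite /v scalerDr !scalerA -addrA; congr (_ + (_ *: _ + _ *: _)); first by field.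
  by rewrite /s; field; rewrite -/s.
have := cvx x v _ H2; rewrite (fin x)// (fin v)// -!EFinM -EFinD => Hw.
have woo : (phi (p *: x + (1 - p) *: v)%R < +oo)%E.
  by apply: le_lt_trans Hw _; rewrite ltry.
split=> //; move: Hw Hv; rewrite (fin _ woo) (fin v)// !lee_fin /=.
move=> Hw Hv; apply: le_trans Hw _.
have : (1 - p) * fine (phi v) <=
    (1 - p) * (q / s * fine (phi y) + (1 - q / s) * fine (phi z)).
  by apply: ler_wpM2l => //; lra.
have -> : (1 - p) * (q / s * fine (phi y) + (1 - q / s) * fine (phi z)) =
    q * fine (phi y) + r * fine (phi z).
  have -> : 1 - p = s by rewrite /s; lra.
  by rewrite /s; field; rewrite -/s.
lra.
Qed.

End SmoothConvex.

(** * The proximal step: existence and three-point inequality *)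

Section Prox.
Context {R : realType} {d : nat}.
Variable phi : 'rV[R]_d -> \bar R.
Hypothesis phi_gtNy : forall v, (-oo < phi v)%E.

(** Completing the square turns the objective, up to a constant, into the proximal one centred at
    the gradient step [z - k *: g]. *)
Lemma prox_linear_exists (k : R) z g : 0 < k -> admits_prox phi ->
  exists x, is_argmin (fun u =>
    (1 / (2 * k) * enorm (u - z) ^+ 2 + dotp g u)%:E + phi u)%E x.
Proof.
move=> k0 /(_ k (z - k *: g) k0) [x xmin]; exists x => u.
have E v : ((1 / (2 * k) * enorm (v - z) ^+ 2 + dotp g v)%:E + phi v =
    phi v + ((2 * k)^-1 * enorm (v - (z - k *: g)) ^+ 2)%:E +
    (dotp g z - k / 2 * dotp g g)%:E)%E.
  rewrite [LHS]addeC -addeA -EFinD; congr (_ + _)%E; congr EFin.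
  have -> : v - (z - k *: g) = (v - z) + k *: g by rewrite opprB addrA addrAC.
  rewrite !sqr_enorm.
  rewrite [in RHS]dotpDl ![in RHS](dotpDr _ (v - z)) !(dotpZl k, dotpZr k).
  rewrite (dotpC (v - z) g) (dotpDr g v) (dotpNr g).
  by field; rewrite gt_eqF.
by rewrite !E leeD2r.
Qed.

(** The right-hand side expands to [2 k <u - zp, zp - z>], so the claim is first-order optimality of
    [zp] in the direction [u - zp], with [phi] bounded by convexity along the segment. *)
Lemma prox_three_point (k : R) z g zp u : convex_ereal phi ->
  is_argmin (fun u => (k * enorm (u - z) ^+ 2 + dotp g u)%:E + phi u)%E zp ->
  (phi u < +oo)%E ->
  (phi zp < +oo)%E /\
  dotp g (zp - u) + fine (phi zp) - fine (phi u) <=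
    k * (enorm (u - z) ^+ 2 - enorm (u - zp) ^+ 2 - enorm (zp - z) ^+ 2).
Proof.
move=> cvx zmin uoo.
have fin v : (phi v < +oo)%E -> phi v = (fine (phi v))%:E.
  by move=> voo; rewrite fineK// fin_real// phi_gtNy voo.
have zoo : (phi zp < +oo)%E.
  have := zmin u; rewrite (fin u)// -EFinD => H.
  have := le_lt_trans H (ltry _); by case: (phi zp) => // r _; rewrite ltry.
split=> //.
set c := k * (enorm (u - z) ^+ 2 - enorm (u - zp) ^+ 2 - enorm (zp - z) ^+ 2).
set A := c - (dotp g (zp - u) + fine (phi zp) - fine (phi u)).
set B := k * dotp (u - zp) (u - zp).
(* Optimality of [zp] against [zp + t (u - zp)], divided by [t]. *)
have H (t : R) : 0 < t <= 1 -> 0 <= A + t * B.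
  move=> /andP[t0 t1].
  have tt : 0 <= t <= 1 by lra.
  have := cvx u zp t tt; rewrite (fin u)// (fin zp)// -!EFinM -EFinD => Hc.
  set v := t *: u + (1 - t) *: zp in Hc.
  have voo : (phi v < +oo)%E by apply: le_lt_trans Hc (ltry _).
  move: Hc (zmin v); rewrite (fin v)// (fin zp)// -!EFinD !lee_fin /= => Hc.
  rewrite !sqr_enorm.
  have -> : v - z = t *: (u - zp) + (zp - z).
    by rewrite /v scalerBl scale1r scalerBr -!addrA; congr (_ + _); rewrite addrCA.
  have -> : dotp g v = t * dotp g (u - zp) + dotp g zp.
    by rewrite /v !dotpE; ring.
  rewrite (dotpDl (t *: _)) !(dotpDr _ (t *: _)) !(dotpZl t, dotpZr t).
  rewrite (dotpC (zp - z) (u - zp)) => Hz.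
  have Ec : c = 2 * (k * dotp (u - zp) (zp - z)).
    rewrite /c !sqr_enorm.
    have -> : u - z = (u - zp) + (zp - z) by rewrite addrA subrK.
    by rewrite (dotpDl (u - zp)) !(dotpDr _ (u - zp)) (dotpC (zp - z) (u - zp)); ring.
  have Eg : dotp g (zp - u) = - dotp g (u - zp) by rewrite -dotpNr opprB.
  rewrite /A /B Ec Eg -(pmulr_rge0 _ t0).
  move: Hz Hc; set pv := fine (phi v); set pz := fine (phi zp); set pu := fine (phi u).
  set q1 := dotp (u - zp) (u - zp); set q2 := dotp (u - zp) (zp - z).
  set q3 := dotp (zp - z) (zp - z); set q4 := dotp g (u - zp).
  move=> Hz Hc.
  have -> : t * (2 * (k * q2) - (- q4 + pz - pu) + t * (k * q1)) =
    (k * (t * (t * q1) + t * q2 + (t * q2 + q3)) + (t * q4 + dotp g zp) +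
     (t * pu + (1 - t) * pz)) - (k * q3 + dotp g zp + pz) by ring.
  lra.
suff : 0 <= A by rewrite subr_ge0.
move: H; clearbody A B => H.
case: (leP 0 A) => // A0; exfalso.
have [B0|B0] := leP B 0.
  by have := H 1; rewrite ltr01 lexx => /(_ isT); lra.
(* Replaces the limit [t -> 0]: this choice gives [t * B <= - A / 2], hence
   [A + t * B <= A / 2 < 0]. *)
set t := Num.min 1 (- A / (2 * B)).
have t0 : 0 < t by rewrite lt_min ltr01 divr_gt0// ?oppr_gt0// mulr_gt0.
have t1 : t <= 1 by rewrite ge_min lexx.
have tB : t * B <= - A / 2.
  have : t <= - A / (2 * B) by rewrite ge_min lexx orbT.
  rewrite ler_pdivlMr ?mulr_gt0//; lra.
have := H t; rewrite t0 t1 => /(_ isT); lra.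
Qed.

End Prox.

(** * The parameter sequences *)

Section PowR.
Context {R : realType}.
Implicit Types a b x : R.

(** The increment is [x^c (q^c - 1)] with [q = (x + 1) / x >= 1], and for [c >= 0] both factors are
    nonnegative and nondecreasing in [c]. *)
Lemma powR_incrementW a b x : 0 <= a -> a <= b -> 1 <= x ->
  (x + 1) `^ a - x `^ a <= (x + 1) `^ b - x `^ b.
Proof.
move=> a0 ab x1.
have x0 : 0 < x by lra.
have E c : (x + 1) `^ c - x `^ c = x `^ c * (((x + 1) / x) `^ c - 1).
  rewrite mulrBr mulr1 -powRM ?(ltW x0)//; last by rewrite divr_ge0//; lra.
  by rewrite mulrC divfK// gt_eqF.
have q1 : 1 <= (x + 1) / x by rewrite ler_pdivlMr//; lra.
rewrite !E; apply: ler_pM.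
- exact: powR_ge0.
- by rewrite subr_ge0 -[leLHS](powRr0 ((x + 1) / x)); apply: ler_powR.
- exact: ler_powR x1 _ _ ab.
- by rewrite lerB// (ler_powR q1 ab).
Qed.

End PowR.

(** * Size and growth of the weights [alpha_t] *)

Section ParameterBounds.
Context {R : realType}.
Variable a : R.
Hypothesis a01 : 0 <= a <= 1.
Local Notation al := (alpha_ a).

Lemma sqrt2_itv : 1 <= Num.sqrt (2 : R) <= 3 / 2.
Proof.
have s0 : 0 <= Num.sqrt (2 : R) := sqrtr_ge0 _.
have : Num.sqrt (2 : R) ^+ 2 = 2 by rewrite sqr_sqrtr.
by set s := Num.sqrt _ in s0 *; nra.
Qed.

Lemma powR17_itv : 16 / 17 <= (17 / 16 : R) `^ (a - 1) <= 1.
Proof.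
have h01 := a01; have h : (1 : R) <= 17 / 16 by lra.
apply/andP; split; last first.
  by rewrite -[leRHS](powRr0 (17 / 16 : R)); apply: ler_powR => //; lra.
have -> : 16 / 17 = (17 / 16 : R) `^ (-1).
  by rewrite powR_inv1; [field | lra].
by apply: ler_powR => //; lra.
Qed.

Lemma a_coef_itv : 1 / 5 <= a_coef a <= 6.
Proof.
have := sqrt2_itv; have := powR17_itv; rewrite /a_coef.
by do ![case: ifP => _]; lra.
Qed.

(** The quantity is [alpha_ a 17]. Being at most 6, it does not jump above the initial constant
    phase; exceeding 1, it keeps [1 - (alpha_ a 17)^-1] positive, as the choice of [c_par] requires.
    Each branch follows from monotonicity of [17^a] in the exponent. *)
Lemma a_coef17_itv : 1 < a_coef a * 17 `^ a <= 6.
Proof.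
have s2 := sqrt2_itv; have h17 := powR17_itv; rewrite /a_coef.
have le17 (x y : R) : x <= y -> (17 : R) `^ x <= 17 `^ y.
  by move=> xy; apply: ler_powR => //; lra.
have e1 : (17 : R) `^ 1 = 17 by rewrite powRr1.
have e0 : (17 : R) `^ 0 = 1 by rewrite powRr0.
have e12 : 4 <= (17 : R) `^ (1 / 2) <= 21 / 5.
  rewrite mul1r powR12_sqrt//.
  have : Num.sqrt (17 : R) ^+ 2 = 17 by rewrite sqr_sqrtr.
  have := sqrtr_ge0 (17 : R); set s := Num.sqrt _.
  by nra.
(* [17^(3/4)] is the cube of [s = 17^(1/4)], and [s >= 2] because [s^4 = 17 > 16]. *)
have e34 : 8 <= (17 : R) `^ (3 / 4).
  have -> : (3 / 4 : R) = 4^-1 * 3%:R by field.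
  rewrite powRrM powR_mulrn ?powR_ge0//.
  have : ((17 : R) `^ 4^-1) ^+ 4 = 17.
    by rewrite -powR_mulrn ?powR_ge0// -powRrM mulVf ?powRr1.
  have := powR_ge0 (17 : R) 4^-1; set s := powR _ _ => s0 s4.
  have s2' : 2 <= s.
    rewrite leNgt; apply/negP => s_lt; have s_sq : s ^+ 2 <= 4 by nra.
    have : (s ^+ 2) ^+ 2 = 17 by rewrite -exprM.
    by have := sqr_ge0 s; nra.
  have -> : (8 : R) = 2 ^+ 3 by ring.
  by apply: lerXn2r => //; rewrite nnegrE; lra.
case: ifP => [/eqP ->|a0]; first by rewrite e0; lra.
case: ifP => [a12|a12].
  have := le17 _ _ (proj1 (andP a01)); have := le17 _ _ a12; rewrite e0.
  by set s := powR _ a; set q := Num.sqrt 2 in s2 *; nra.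
have ha12 : 1 / 2 <= a by rewrite ltW// ltNge a12.
case: ifP => [a34|a34].
  have := le17 _ _ ha12; have := le17 _ _ (proj2 (andP a01)); rewrite e1.
  by lra.
have ha34 : 3 / 4 <= a by rewrite ltW// ltNge a34.
have := le17 _ _ ha34; have := le17 _ _ (proj2 (andP a01)); rewrite e1.
set s := powR 17 a; set q := powR _ (a - 1) in h17 *.
by nra.
Qed.

(** For [a > 1/2], compare with exponent 1: the increment is at most 1 and the coefficient at most
    1/3. For [0 < a <= 1/2], compare with the square root, whose increment
    [1 / (sqrt (x + 1) + sqrt x)] is at most 1/8. *)
Lemma a_coef_increment (x : R) : 17 <= x ->
  a_coef a * ((x + 1) `^ a - x `^ a) <= 1 / 3.
Proof.
move=> x17; have s2 := sqrt2_itv; have h17 := powR17_itv; rewrite /a_coef.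
have x1 : 1 <= x by lra.
have inc0 : 0 <= (x + 1) `^ a - x `^ a.
  by have h01 := a01; rewrite subr_ge0; apply: ge0_ler_powR; rewrite ?nnegrE; lra.
have inc1 : (x + 1) `^ a - x `^ a <= 1.
  have /andP[a0 a1] := a01.
  by have := powR_incrementW a0 a1 x1; rewrite !powRr1; lra.
case: ifP => [/eqP ->|_]; first by rewrite !powRr0; lra.
case: ifP => [a12|_]; last by case: ifP => _; nra.
have : (x + 1) `^ a - x `^ a <= 1 / 8.
  have /andP[a0 _] := a01.
  have := powR_incrementW a0 a12 x1; rewrite mul1r !powR12_sqrt; try lra.
  have : Num.sqrt (x + 1) ^+ 2 = x + 1 by rewrite sqr_sqrtr//; lra.
  have : Num.sqrt x ^+ 2 = x by rewrite sqr_sqrtr//; lra.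
  have := sqrtr_ge0 x; have := sqrtr_ge0 (x + 1).
  set p := Num.sqrt _; set q := Num.sqrt _ => p0 q0 eq ep.
  have q4 : 4 <= q by nra.
  have p4 : 4 <= p by nra.
  have q8 : q <= p by nra.
  have : (p - q) * (p + q) = 1 by rewrite -subr_sqr ep eq; ring.
  by nra.
move: inc0; set s := _ - _ `^ a; set q := Num.sqrt 2 in s2 *.
by nra.
Qed.

Lemma alpha_small t : (t <= 16)%N -> al t = 6.
Proof. by rewrite /alpha_ => ->. Qed.

Lemma alpha_large t : (17 <= t)%N -> al t = a_coef a * t%:R `^ a.
Proof. by move=> t17; rewrite /alpha_ ifN// -ltnNge. Qed.

Lemma alpha17_itv : 1 < al 17 <= 6.
Proof. by rewrite alpha_large// a_coef17_itv. Qed.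

Lemma alpha_nondecreasing s t : (17 <= s <= t)%N -> al s <= al t.
Proof.
move=> /andP[hs st]; rewrite !alpha_large ?(leq_trans hs)//.
have /andP[c0 _] := a_coef_itv; have /andP[a0 _] := a01.
apply: ler_wpM2l; first by lra.
by apply: ge0_ler_powR; rewrite ?nnegrE ?ler0n ?ler_nat.
Qed.

Lemma alpha_ge17 t : al 17 <= al t.
Proof.
have [t16|t17] := leqP t 16; last by apply: alpha_nondecreasing.
by rewrite [leRHS]alpha_small//; have /andP[] := alpha17_itv.
Qed.

Lemma alpha_gt1 t : 1 < al t.
Proof. by have /andP[h _] := alpha17_itv; apply: lt_le_trans h (alpha_ge17 t). Qed.

Lemma alpha_powR_itv t : (0 < t)%N ->
  1 / 5 * t%:R `^ a <= al t <= 6 * t%:R `^ a.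
Proof.
move=> t0; have /andP[c0 c1] := a_coef_itv; have /andP[a0 a1] := a01.
have t1 : (1 : R) <= t%:R by rewrite ler1n.
have p1 : 1 <= t%:R `^ a by rewrite -[leLHS](powRr0 (t%:R : R)); apply: ler_powR.
have [t16|t17] := leqP t 16; last first.
  by rewrite alpha_large// !ler_pM2r ?c0//; apply: lt_le_trans p1.
have : t%:R `^ a <= t%:R by apply: ler1_powR.
have : t%:R <= (16 : R) by rewrite ler_nat.
by rewrite alpha_small//; lra.
Qed.

Lemma alphaS_le t : (17 <= t)%N -> al t.+1 <= al t + 1 / 3.
Proof.
move=> t17; rewrite (alpha_large t17) (alpha_large (leqW t17)).
have := @a_coef_increment t%:R; rewrite natr1 ler_nat => /(_ t17).
by rewrite mulrBr; lra.
Qed.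

(** From index 17 on, factor the difference of squares and use increments of at most 1/3; before
    that the weights do not increase. Through [p_denS] this makes [Q_t] grow by at least a third of
    the new weight. *)
Lemma sqr_alphaS t : al t.+1 ^+ 2 - al t ^+ 2 <= 2 / 3 * al t.+1.
Proof.
have h1 := alpha_gt1 t; have h2 := alpha_gt1 t.+1.
have [t16|t17] := leqP t 16.
  rewrite (alpha_small t16); move: t16; rewrite leq_eqVlt => /orP[/eqP ->|t16].
    by have := alpha17_itv; nra.
  by rewrite alpha_small//; lra.
have := alphaS_le t17.
have : al t <= al t.+1 by apply: alpha_nondecreasing; rewrite t17 leqnSn.
by nra.
Qed.

Lemma c_par_ge3 : 3 <= c_par a 1.
Proof.
rewrite /c_par; set m := Num.max 2 _.
by have : 2 <= m; [rewrite le_max lexx | lra].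
Qed.

Lemma xi_itv : 0 < xi a 1 <= 1 / 3.
Proof.
have c3 := c_par_ge3; have c0 : 0 < c_par a 1 by lra.
by rewrite /xi !mul1r invr_gt0 c0 lef_pV2 ?posrE.
Qed.

(** Makes the weight of [y_t] in [x_{t+1}] nonnegative. The last entry of the maximum in [c_par]
    gives [xi <= 1 - 1 / alpha_17], while [tau_t <= 1 / alpha_17]. *)
Lemma xi_tau_le1 t : xi a 1 + tau_ a t <= 1.
Proof.
have al17 := alpha17_itv; have al17t := alpha_ge17 t.
have h : (1 - (al 17)^-1)^-1 + 1 <= c_par a 1.
  by rewrite /c_par lerD2r invr1 mul1r !le_max lexx !orbT.
have al17_gt0 : 0 < al 17 by lra.
have alt_gt0 : 0 < al t by lra.
set u := 1 - (al 17)^-1 in h.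
have u0 : 0 < u by rewrite subr_gt0 invf_lt1//; lra.
have : tau_ a t <= 1 - u.
  by rewrite /tau_ div1r /u opprB addrC subrK lef_pV2// posrE.
suff : xi a 1 <= u by lra.
rewrite /xi !mul1r -[leRHS]invrK lef_pV2 ?posrE ?invr_gt0//; first lra.
by have := c_par_ge3; lra.
Qed.

(* [Q_t], the denominator of [p_t]. *)
Definition p_den (talpha0 : R) t :=
  talpha0 + al 0 ^+ 2 - al t ^+ 2 + \sum_(1 <= j < t.+1) al j.

(** * Growth of [Q_t] and bounds on the replacement probability *)

Section Denominator.
Variable talpha0 : R.
Hypothesis talpha0_ge : xi a 1 * al 1 ^+ 2 <= talpha0.
Local Notation Q := (p_den talpha0).

Lemma p_den0 : Q 0 = talpha0.
Proof. by rewrite /p_den big_geq// addr0 addrK. Qed.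

Lemma p_denS t : Q t.+1 = Q t + (al t ^+ 2 - al t.+1 ^+ 2 + al t.+1).
Proof. by rewrite /p_den big_nat_recr//=; ring. Qed.

Lemma p_den_increment t : Q t + 1 / 3 * al t.+1 <= Q t.+1.
Proof. by rewrite p_denS; have := sqr_alphaS t; lra. Qed.

Lemma p_den_ge0 t : 0 <= Q t.
Proof.
elim: t => [|t IH].
  rewrite p_den0; apply: le_trans talpha0_ge.
  by rewrite mulr_ge0 ?sqr_ge0//; have := xi_itv; lra.
by have := p_den_increment t; have := alpha_gt1 t.+1; lra.
Qed.

Lemma p_den_gt0 t : 0 < Q t.+1.
Proof.
by have := p_den_increment t; have := alpha_gt1 t.+1; have := p_den_ge0 t; lra.
Qed.

(** Equivalent to [p_{t+1} <= 1], by [p_denE]. Up to [t = 16] the left side is at most its value for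
    [alpha_1 = 6], which [talpha0] dominates; afterwards [Q] grows by at least [alpha_{t+1} / 3] per
    step, the left side by at most [2/9 alpha_{t+2}]. *)
Lemma xi_alpha_le_p_den t : xi a 1 * al t.+1 ^+ 2 <= Q t.
Proof.
have x := xi_itv.
have small s : (s <= 16)%N -> xi a 1 * al s.+1 ^+ 2 <= Q s.
  move=> s16; apply: (@le_trans _ _ talpha0).
    apply: le_trans talpha0_ge; apply: ler_wpM2l; first by lra.
    rewrite (@alpha_small 1)//; have h := alpha_gt1 s.+1.
    suff : al s.+1 <= 6 by nra.
    move: s16; rewrite leq_eqVlt => /orP[/eqP ->|s16].
      by have /andP[] := alpha17_itv.
    by rewrite alpha_small.
  elim: s {s16} => [|s IH]; first by rewrite p_den0.
  by have := p_den_increment s; have := alpha_gt1 s.+1; lra.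
have [|t17] := leqP t 16; first exact: small.
elim: t t17 => // t IH; rewrite ltnS leq_eqVlt => /orP[/eqP <-|t17].
  have := small _ (leqnn 16); have := p_den_increment 16.
  have := sqr_alphaS 17; have := alphaS_le (leqnn 17); have := alpha_gt1 17.
  by nra.
have := IH t17; have := p_den_increment t; have := sqr_alphaS t.+1.
have := @alphaS_le t.+1 (leq_trans t17 (leqnSn _)); have := alpha_gt1 t.+1.
by nra.
Qed.

(** Each increment of [Q] is at least [t^a / 15], whereas [t^(1 + a)] increases by at most [2 t^a],
    with [t] the new index; the ratio gives 30. *)
Lemma p_den_growth t : t%:R * t%:R `^ a / 30 <= Q t.
Proof.
have /andP[a0 a1] := a01.
elim: t => [|t IH]; first by rewrite mul0r mul0r p_den_ge0.
suff H : t.+1%:R * t.+1%:R `^ a <= t%:R * t%:R `^ a + 2 * t.+1%:R `^ a.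
  have := p_den_increment t; have /andP[h _] := @alpha_powR_itv t.+1 isT.
  by lra.
case: t {IH} => [|t]; first by rewrite powR1; lra.
set x : R := t.+1%:R; have x1 : 1 <= x by rewrite ler1n.
have x0 : 0 < x by lra.
rewrite -natr1 -/x.
have -> : (x + 1) `^ a = x `^ a * ((x + 1) / x) `^ a.
  by rewrite -powRM ?(ltW x0) ?divr_ge0//; [rewrite mulrC divfK ?gt_eqF|lra..].
have q1 : 1 <= (x + 1) / x by rewrite ler_pdivlMr//; lra.
have qr : ((x + 1) / x) `^ a <= (x + 1) / x by apply: ler1_powR.
have q1r : 1 <= ((x + 1) / x) `^ a.
  by rewrite -[leLHS](powRr0 ((x + 1) / x)); apply: ler_powR.
have : x * ((x + 1) / x) `^ a <= x + 1.
  by rewrite mulrC -ler_pdivlMr.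
have := powR_ge0 x a; set s := x `^ a; set r := ((x + 1) / x) `^ a.
move=> s0 xr.
have : s * (x * r) <= s * (x + 1) by apply: ler_wpM2l.
have : s * 1 <= s * r by apply: ler_wpM2l.
by nra.
Qed.

Lemma p_denE t :
  p_ a 1 talpha0 t.+1 * Q t.+1 = Q t.+1 - Q t + xi a 1 * al t.+1 ^+ 2.
Proof.
rewrite /p_ -/(p_den talpha0 t.+1) divfK ?gt_eqF ?p_den_gt0//.
by rewrite p_denS; ring.
Qed.

Lemma p_itv t : 0 <= p_ a 1 talpha0 t.+1 <= 1.
Proof.
have Q0 := p_den_gt0 t.
rewrite -(pmulr_lge0 _ Q0) -[X in _ && X](ler_pM2r Q0) p_denE mul1r.
have := p_den_increment t; have := alpha_gt1 t.+1.
have := xi_alpha_le_p_den t; have := xi_itv.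
have := sqr_ge0 (al t.+1).
by set s := al t.+1 ^+ 2; nra.
Qed.

(** This is [p_t = O(t^(a - 1))]: the numerator is [O(alpha_t^2) = O(t^(2a))] and the denominator at
    least [t^(1 + a) / 30]. *)
Lemma p_le t : p_ a 1 talpha0 t.+1 <= (200 * 200) * (t.+1%:R `^ a / t.+1%:R).
Proof.
have Q0 := p_den_gt0 t.
rewrite -(ler_pM2r Q0) p_denE [X in X - _ + _ <= _]p_denS.
have t1 : (0 : R) < t.+1%:R by rewrite ltr0n.
have /andP[_ h] := @alpha_powR_itv t.+1 isT.
have h1 := alpha_gt1 t.+1; have h0 := alpha_gt1 t.
have hx := xi_itv.
have H0 : al t ^+ 2 <= 36 * al t.+1 ^+ 2.
  have [t16|t17] := leqP t 16; first by rewrite (alpha_small t16); nra.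
  have : al t <= al t.+1 by apply: alpha_nondecreasing; rewrite t17 leqnSn.
  by nra.
set s := t.+1%:R `^ a in h *.
have G := p_den_growth t.+1; rewrite -/s in G.
have s0 : 0 <= s := powR_ge0 _ _.
(* The constants multiply to [37 * 36 * 30 <= 200 * 200]. *)
apply: (@le_trans _ _ (37 * al t.+1 ^+ 2)).
  have : xi a 1 * al t.+1 ^+ 2 <= 1 * al t.+1 ^+ 2.
    by apply: ler_wpM2r; [exact: sqr_ge0|lra].
  by nra.
apply: (@le_trans _ _ (37 * (6 * s) ^+ 2)).
  by apply: ler_wpM2l => //; apply: lerXn2r => //; rewrite nnegrE; lra.
apply: (@le_trans _ _ ((200 * 200) * (s / t.+1%:R) * (t.+1%:R * s / 30))).
  have -> : (200 * 200) * (s / t.+1%:R) * (t.+1%:R * s / 30) = 200 * 200 / 30 * s ^+ 2.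
    by field; rewrite gt_eqF.
  by have := sqr_ge0 s; nra.
apply: ler_wpM2l G; apply: mulr_ge0; first by lra.
exact: divr_ge0 s0 (ltW t1).
Qed.

End Denominator.
End ParameterBounds.

(** * Expected decrease of the potential *)

Section Descent.
Context {R : realType}.
Variables (P : problem R) (L : R) (xs : 'rV[R]_(Defs.dim P)).
Hypothesis Pstd : standing L xs.

Local Notation n := (nfun P).
Local Notation f := (@favg R P).
Local Notation l := (@reg R P).
Local Notation fi := (@fi R P).
Local Notation avg F := (n%:R^-1 * \sum_(i < n) F i).
Implicit Types x y z w u g : 'rV[R]_(Defs.dim P).

Lemma ler_avg (F G : 'I_n -> R) : (forall i, F i <= G i) -> avg F <= avg G.
Proof.
by move=> FG; apply: ler_wpM2l; [rewrite invr_ge0 | exact: ler_sum].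
Qed.

Lemma avgD (F G : 'I_n -> R) : avg (fun i => F i + G i) = avg F + avg G.
Proof. by rewrite big_split mulrDr. Qed.

Lemma avgZ (k : R) (F : 'I_n -> R) : avg (fun i => k * F i) = k * avg F.
Proof. by rewrite -mulr_sumr mulrCA. Qed.

Lemma avg_const (k : R) : avg (fun=> k) = k.
Proof.
rewrite sumr_const card_ord -[k *+ _]mulr_natl mulKf// pnatr_eq0 -lt0n.
exact: nfun_gt0 Pstd.
Qed.

Lemma grad_favg x : grad f x = n%:R^-1 *: \sum_(i < n) grad (fi i) x.
Proof.
have -> : f = n%:R^-1 \*: \sum_(i < n) fi i.
  by apply/funext => v; rewrite /favg /= fct_sumE.
have der i v : derivable (fi i) x v.
  by apply: diff_derivable; have [] := fi_smooth Pstd i.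
apply/rowP => k; rewrite !mxE summxE deriveZ; last exact: derivable_sum.
by rewrite derive_sum//; congr (_ * _); apply: eq_bigr => i _; rewrite mxE.
Qed.

Lemma dotp_grad_favg x v :
  dotp (grad f x) v = avg (fun i => dotp (grad (fi i) x) v).
Proof. by rewrite grad_favg dotpZl dotp_suml. Qed.

Lemma favg_smooth x y :
  f y <= f x + dotp (grad f x) (y - x) + L / 2 * enorm (y - x) ^+ 2.
Proof.
rewrite dotp_grad_favg -[L / 2 * _]avg_const -!avgD.
by apply: ler_avg => i; have [_] := fi_smooth Pstd i.
Qed.

Lemma favg_convex x y : f x + dotp (grad f x) (y - x) <= f y.
Proof.
rewrite dotp_grad_favg -avgD.
by apply: ler_avg => i; apply: fi_convex Pstd i _ _.
Qed.

(* The estimator [g~] of a mini-batch of size one. *)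
Definition svrg x w (j : 'I_n) : 'rV[R]_(Defs.dim P) :=
  grad (fi j) x - grad (fi j) w + grad f w.

(** Unbiasedness of the estimator, tested against a vector. *)
Lemma dotp_svrg_avg x w v : avg (fun j => dotp (svrg x w j) v) = dotp (grad f x) v.
Proof.
rewrite (dotp_grad_favg x).
under eq_bigr do rewrite !dotpDl dotpNl.
rewrite avgD avgD avg_const dotp_grad_favg.
under [X in _ + n%:R^-1 * X + _]eq_bigr do rewrite -mulN1r.
by rewrite avgZ; ring.
Qed.

(** The error is [D j - m] with [m] the mean of [D], so the variance is at most the second moment of
    [D], which [smooth_convex_gradient_gap] bounds term by term. *)
Lemma svrg_variance x w :
  avg (fun j => enorm (grad f x - svrg x w j) ^+ 2)
    <= 2 * L * (f w - f x - dotp (grad f x) (w - x)).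
Proof.
pose D j := grad (fi j) w - grad (fi j) x.
pose m := grad f w - grad f x.
apply: (@le_trans _ _ (avg (fun j => enorm (D j) ^+ 2))).
  have DmE j : enorm (grad f x - svrg x w j) ^+ 2 =
      enorm (D j) ^+ 2 + (- 2 * dotp (D j) m + dotp m m).
    have -> : grad f x - svrg x w j = D j - m.
      rewrite /svrg /D /m; move: (grad f x) (grad f w) (grad _ x) (grad _ w).
      by move=> p q r s; apply/rowP => k; rewrite !mxE; ring.
    exact: sqr_enormB.
  have Dm : avg (fun j => dotp (D j) m) = dotp m m.
    rewrite [RHS]dotpDl dotpNl !dotp_grad_favg -mulN1r -avgZ -avgD.
    by congr (_ * _); apply: eq_bigr => j _; rewrite dotpDl dotpNl mulN1r.
  under eq_bigr do rewrite DmE.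
  by rewrite !avgD avgZ avg_const Dm; have := dotp_ge0 m; lra.
have -> : f w - f x - dotp (grad f x) (w - x) =
    avg (fun j => fi j w - fi j x - dotp (grad (fi j) x) (w - x)).
  by rewrite dotp_grad_favg /favg -!mulrBr -!sumrB.
rewrite -avgZ; apply: ler_avg => j.
by apply: smooth_convex_gradient_gap; [exact: L_gt0 Pstd | exact: fi_smooth Pstd j
  | exact: fi_convex Pstd j].
Qed.

Definition finite_reg x := (l x < +oo)%E.

(** Real counterpart of [objective], faithful only where the regularizer is finite, since [fine]
    sends infinite values to 0; hence the [finite_reg] side conditions below. *)
Definition Fval x := f x + fine (l x).

Lemma reg_fineK x : finite_reg x -> l x = (fine (l x))%:E.
Proof.
move=> xoo; rewrite fineK// fin_real//; apply/andP; split=> //.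
exact: (reg_proper Pstd).1.
Qed.

Lemma objective_fineK x : finite_reg x -> objective x = (Fval x)%:E.
Proof. by move=> xoo; rewrite /objective (reg_fineK xoo) -EFinD. Qed.

Lemma xstar_finite : finite_reg xs.
Proof.
have [v voo] := (reg_proper Pstd).2.
have := xstar_sol Pstd v; rewrite (objective_fineK voo) /objective => H.
have := le_lt_trans H (ltry _); rewrite /finite_reg.
by case: (l xs) => // r _; rewrite ltry.
Qed.

Lemma Fval_xstar_le x : finite_reg x -> Fval xs <= Fval x.
Proof.
move=> xoo; have := xstar_sol Pstd x.
by rewrite !objective_fineK ?lee_fin//; exact: xstar_finite.
Qed.

(** * One iteration with a fixed gradient estimator *)

Section MirrorStep.
Variables (c eta al x_i : R) (x y z w u : 'rV[R]_(Defs.dim P)).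
Let tau := 1 / al.
Hypotheses (c0 : 0 < c) (eta0 : 0 < eta) (eta_le : eta <= 1 / (c * L + L))
  (al1 : 1 < al) (xi0 : 0 < x_i) (xi_tau : x_i + tau <= 1)
  (xE : x = tau *: z + x_i *: w + (1 - x_i - tau) *: y)
  (yoo : finite_reg y) (woo : finite_reg w) (uoo : finite_reg u).

Let prox_obj g v :=
  ((1 / (2 * al * eta) * enorm (v - z) ^+ 2 + dotp g v)%:E + l v)%E.

(** A minimizer exists, so the default value 0 of [argmin] is never what the algorithm receives. *)
Lemma prox_obj_argmin g : is_argmin (prox_obj g) (argmin (prox_obj g)).
Proof.
apply: (@xgetPex _ _ [set v | is_argmin (prox_obj g) v]).
have ae : 0 < al * eta by rewrite mulr_gt0//; have := al1; lra.
have [v vmin] := prox_linear_exists z g ae (reg_prox Pstd).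
by exists v; move: vmin; rewrite /prox_obj mulrA.
Qed.

Lemma mirror_step_finite g zp : is_argmin (prox_obj g) zp ->
  finite_reg (x + tau *: (zp - z)).
Proof.
move=> zmin.
have [zoo _] := prox_three_point (reg_proper Pstd).1 (reg_convex Pstd) zmin uoo.
have -> : x + tau *: (zp - z) = tau *: zp + x_i *: w + (1 - x_i - tau) *: y.
  by rewrite xE; apply/rowP => k; rewrite !mxE; ring.
have tau0 : 0 < tau by rewrite divr_gt0//; have := al1; lra.
have := convex_comb3 (reg_proper Pstd).1 (reg_convex Pstd)
  (ltW tau0) xi0 _ _ zoo woo yoo.
by case/(_ (1 - x_i - tau)); [have := xi_tau; lra | ring | ].
Qed.

(** The new [y] is a convex combination of [zp], [w] and [y], which bounds its regularizer;
    smoothness bounds [f] there. Replacing the gradient by [g] costs a Young term, and the prox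
    inequality handles [g]. *)
Lemma mirror_step g zp : is_argmin (prox_obj g) zp ->
  Fval (x + tau *: (zp - z)) <=
    f x + tau * dotp g (u - z) + (2 * c * L)^-1 * enorm (grad f x - g) ^+ 2
    + tau * fine (l u) + x_i * fine (l w) + (1 - x_i - tau) * fine (l y)
    + tau ^+ 2 / (2 * eta) * (enorm (u - z) ^+ 2 - enorm (u - zp) ^+ 2).
Proof.
move=> zmin; have L0 := L_gt0 Pstd.
have al0 : 0 < al by have := al1; lra.
have tau0 : 0 < tau by rewrite divr_gt0.
have [zoo H3] := prox_three_point (reg_proper Pstd).1 (reg_convex Pstd) zmin uoo.
have ypE : x + tau *: (zp - z) = tau *: zp + x_i *: w + (1 - x_i - tau) *: y.
  by rewrite xE; apply/rowP => k; rewrite !mxE; ring.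
have [_ H4] : finite_reg (tau *: zp + x_i *: w + (1 - x_i - tau) *: y) /\
    fine (l (tau *: zp + x_i *: w + (1 - x_i - tau) *: y)) <=
    tau * fine (l zp) + x_i * fine (l w) + (1 - x_i - tau) * fine (l y).
  have := convex_comb3 (reg_proper Pstd).1 (reg_convex Pstd)
    (ltW tau0) xi0 _ _ zoo woo yoo.
  by apply; [have := xi_tau; lra | ring].
have := favg_smooth x (x + tau *: (zp - z)).
have -> : x + tau *: (zp - z) - x = tau *: (zp - z) by rewrite addrC addKr.
rewrite /Fval ypE => H1.
set d := zp - z in H1 *; set v := grad f x - g.
(* Young's inequality with parameter [c * L], from the square of [v - c L tau d]. *)
have H2 : 0 <= dotp (v - (c * L * tau) *: d) (v - (c * L * tau) *: d) by exact: dotp_ge0.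
have {}H2 : tau * dotp v d <=
    (2 * c * L)^-1 * dotp v v + c * L / 2 * (tau ^+ 2 * dotp d d).
  rewrite -(@ler_pM2l _ (2 * c * L)) ?mulr_gt0//.
  move: H2; rewrite (dotpDl v) !(dotpDr _ v) !(dotpNl, dotpNr, dotpZl, dotpZr).
  rewrite (dotpC d) => H2; rewrite -subr_ge0.
  apply: le_trans H2 _; rewrite le_eqVlt; apply/orP; left; apply/eqP.
  by field; rewrite !gt_eqF.
(* The step-size condition lets the quadratic term of the prox inequality absorb both [L / 2] from
   smoothness and [c L / 2] from Young. *)
have H5 : (c * L + L) / 2 * (tau ^+ 2 * dotp d d) <=
    tau ^+ 2 / (2 * eta) * dotp d d.
  have cL0 : 0 < c * L + L by rewrite addr_gt0// mulr_gt0.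
  rewrite mulrA; apply: ler_wpM2r; first exact: dotp_ge0.
  rewrite mulrC; apply: ler_wpM2l; first exact: sqr_ge0.
  by rewrite invfM mulrC ler_pM2l// -[leLHS]invrK lef_pV2 ?posrE ?invr_gt0// -div1r.
have {}H3 : tau * dotp g (zp - u) + tau * fine (l zp) - tau * fine (l u) <=
    tau ^+ 2 / (2 * eta) * (enorm (u - z) ^+ 2 - enorm (u - zp) ^+ 2)
    - tau ^+ 2 / (2 * eta) * dotp d d.
  have := H3; rewrite -(ler_pM2l tau0) (sqr_enorm (zp - z)) -/d.
  have -> (s : R) : tau * (1 / (2 * al * eta) * s) = tau ^+ 2 / (2 * eta) * s.
    by rewrite /tau; field; rewrite !gt_eqF.
  lra.
have gE : tau * dotp g (zp - u) = tau * dotp (grad f x) d - tau * dotp v d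
    - tau * dotp g (u - z).
  have -> : zp - u = d - (u - z) by rewrite /d opprB addrA subrK.
  by rewrite /v (dotpDr g) dotpNr dotpDl dotpNl; ring.
move: H1 H3; rewrite gE (sqr_enorm (tau *: d)) (sqr_enorm v).
rewrite !(dotpZl tau) !(dotpZr tau) => H1 H3.
by lra.
Qed.

End MirrorStep.
End Descent.

(** * One iteration averaged over the sampled index *)

Section MeanStep.
Context {R : realType}.
Variables (P : problem R) (L : R) (xs : 'rV[R]_(Defs.dim P)).
Hypothesis Pstd : standing L xs.

Local Notation n := (nfun P).
Local Notation f := (@favg R P).
Local Notation l := (@reg R P).
Local Notation avg F := (n%:R^-1 * \sum_(i < n) F i).

(** Multiply [mirror_step] by [al^2] and average. Convexity of [f] is applied at [u] and [y]; at [w]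
    the variance bound supplies the corresponding term with weight exactly [xi]. All values of [f]
    and its gradient at [x] then cancel. *)
Lemma mean_mirror_step (c eta al x_i : R) (x y z w u : 'rV[R]_(Defs.dim P))
    (zp : 'I_n -> 'rV[R]_(Defs.dim P)) :
  let tau := 1 / al in
  0 < c -> 0 < eta -> eta <= 1 / (c * L + L) -> 1 < al -> x_i = 1 / c ->
  x_i + tau <= 1 -> x = tau *: z + x_i *: w + (1 - x_i - tau) *: y ->
  finite_reg y -> finite_reg w -> finite_reg u ->
  (forall j, is_argmin (fun v => ((1 / (2 * al * eta) * enorm (v - z) ^+ 2
    + dotp (svrg x w j) v)%:E + l v)%E) (zp j)) ->
  avg (fun j => al ^+ 2 * (Fval (x + tau *: (zp j - z)) - Fval u)
              + (2 * eta)^-1 * enorm (u - zp j) ^+ 2)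
  <= x_i * al ^+ 2 * (Fval w - Fval u)
     + ((1 - x_i) * al ^+ 2 - al) * (Fval y - Fval u)
     + (2 * eta)^-1 * enorm (u - z) ^+ 2.
Proof.
move=> tau c0 eta0 eta_le al1 xiE xi_tau xE yoo woo uoo zmin.
have L0 := L_gt0 Pstd; have al0 : 0 < al by lra.
have xi0 : 0 < x_i by rewrite xiE divr_gt0.
set A := f x + tau * fine (l u) + x_i * fine (l w)
   + (1 - x_i - tau) * fine (l y) + tau ^+ 2 / (2 * eta) * enorm (u - z) ^+ 2
   - Fval u.
(* [U] is deterministic, [V] averages to the exact gradient term, [W] to the variance term. *)
pose U (_ : 'I_n) := al ^+ 2 * A.
pose V j := al * dotp (svrg x w j) (u - z).
pose W j := al ^+ 2 * (2 * c * L)^-1 * enorm (grad f x - svrg x w j) ^+ 2.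
apply: (@le_trans _ _ (avg (fun j => U j + V j + W j))).
  apply: ler_avg => j.
  have := mirror_step Pstd c0 eta0 eta_le al1 xi0 xi_tau xE yoo woo uoo (zmin j).
  rewrite -/tau => H; rewrite -subr_ge0 in H; rewrite -subr_ge0.
  move: H; rewrite /U /V /W /A; set a1 := enorm (u - z) ^+ 2.
  set a2 := enorm (u - zp j) ^+ 2; set a3 := Fval u.
  set a4 := Fval _; set a5 := enorm _ ^+ 2; set a6 := dotp _ _ => H.
  have := mulr_ge0 (sqr_ge0 al) H; move: xiE => _; congr (0 <= _).
  by rewrite /tau; field; rewrite !gt_eqF.
rewrite (avgD (fun j => U j + V j)) (avgD U) (avg_const Pstd) !avgZ.
rewrite (dotp_svrg_avg Pstd).
have Hv := svrg_variance Pstd x w.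
have Hu := favg_convex Pstd x u.
have Hy := favg_convex Pstd x y.
have {}Hv : al ^+ 2 * (2 * c * L)^-1
      * avg (fun j => enorm (grad f x - svrg x w j) ^+ 2) <=
    al ^+ 2 * (x_i * (f w - f x - dotp (grad f x) (w - x))).
  have -> : al ^+ 2 * (x_i * (f w - f x - dotp (grad f x) (w - x))) =
      al ^+ 2 * (2 * c * L)^-1 * (2 * L * (f w - f x - dotp (grad f x) (w - x))).
    by rewrite xiE; field; rewrite !gt_eqF.
  by apply: ler_wpM2l => //; rewrite mulr_ge0 ?sqr_ge0// invr_ge0 ltW// !mulr_gt0.
(* The definition of [x], scaled by [al^2] and paired with the gradient; the coefficients match
   those of the convexity inequalities. *)
have gE : al ^+ 2 * dotp (grad f x) x = al * dotp (grad f x) z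
   + x_i * al ^+ 2 * dotp (grad f x) w
   + ((1 - x_i) * al ^+ 2 - al) * dotp (grad f x) y.
  rewrite {2}xE !dotpDr !dotpZr; move: (dotp _ z) (dotp _ w) (dotp _ y) => p q r.
  by rewrite /tau; field; rewrite gt_eqF.
have AE : al ^+ 2 * A = al ^+ 2 * f x + al * fine (l u) + x_i * al ^+ 2 * fine (l w)
   + ((1 - x_i) * al ^+ 2 - al) * fine (l y) + (2 * eta)^-1 * enorm (u - z) ^+ 2
   - al ^+ 2 * (f u + fine (l u)).
  rewrite /A /Fval; move: (f x) (f u) (fine (l y)) (fine (l w)) (fine (l u)).
  move: (enorm _ ^+ 2) => d fx fu ly lw lu.
  by rewrite /tau; field; rewrite !gt_eqF.
have {}Hu : al * (f x + dotp (grad f x) (u - x)) <= al * f u by rewrite ler_pM2l.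
have {}Hy : ((1 - x_i) * al ^+ 2 - al) * (f x + dotp (grad f x) (y - x))
     <= ((1 - x_i) * al ^+ 2 - al) * f y.
  apply: ler_wpM2l => //.
  have -> : (1 - x_i) * al ^+ 2 - al = al ^+ 2 * (1 - x_i - tau).
    by rewrite /tau; field; rewrite gt_eqF.
  by rewrite mulr_ge0 ?sqr_ge0//; move: xi_tau; rewrite /tau; lra.
rewrite /U AE /Fval; move: Hv Hu Hy gE; rewrite !(dotpDr (grad f x)) !(dotpNr (grad f x)).
set a5 := n%:R^-1 * _; set q := al ^+ 2 * _ * a5; clearbody q.
move: (enorm (u - z) ^+ 2) (2 * eta)^-1 => d k.
move: (f x) (f y) (f w) (f u) (fine (l y)) (fine (l w)) (fine (l u)).
move: (dotp _ x) (dotp _ z) (dotp _ w) (dotp _ y) (dotp _ u).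
move=> gx gz gw gy gu fx fy fw fu ly lw lu Hv Hu Hy gE.
lra.
Qed.

End MeanStep.

(** * Expectations over the draws for batches of size one *)

Section Draws.
Context {R : realType}.
Variable S : setup R.
Hypothesis batch1 : batch S = 1%N.
Local Notation n := (nfun (pb S)).
Local Notation p t := (p_ (alpha S) 1 (talpha0 S) t).

(** Only singletons have nonzero probability, namely [1 / n] each, so batches are reindexed by their
    element. *)
Lemma sum_draw (X : draw S -> R) t :
  \sum_J law_draw t J * X J =
  n%:R^-1 * \sum_(j < n) (p t * X ([set j]%SET, true) + (1 - p t) * X ([set j]%SET, false)).
Proof.
transitivity (\sum_(A : {set 'I_n}) \sum_(b : bool) law_draw t (A, b) * X (A, b)).
  by rewrite pair_bigA; apply: eq_bigr => -[].
rewrite (bigID (fun A : {set 'I_n} => #|A| == 1%N)) /= [X in _ + X]big1 ?addr0; last first.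
  move=> A /negbTE A1; apply: big1 => b _.
  by rewrite /law_draw batch1 /= A1 !mul0r.
rewrite (eq_bigl (fun A => A \in [set [set j] | j : 'I_n]%SET)); last first.
  move=> A; apply/cards1P/imsetP => [[j ->]|[j _ ->]]; first by exists j.
  by exists j.
rewrite big_imset /=; last by move=> i j _ _ /set1_inj.
rewrite mulr_sumr; apply: eq_big => [j|j _]; first by rewrite inE.
by rewrite big_bool /law_draw batch1 /= cards1 eqxx bin1; ring.
Qed.

(** Real-valued form of [expect] with a free starting time, which allows induction on the first
    draw. *)
Definition Elaw (t T : nat) (X : seq (draw S) -> R) : R :=
  \sum_(h : T.-tuple (draw S)) law t h * X h.

Lemma Elaw0 t X : Elaw t 0 X = X [::].
Proof.
rewrite /Elaw (bigD1 [tuple]) //= mul1r big1 ?addr0// => h /eqP[].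
exact: tuple0.
Qed.

Lemma ElawS t T X :
  Elaw t T.+1 X = \sum_J law_draw t J * Elaw t.+1 T (fun h => X (J :: h)).
Proof.
rewrite /Elaw (reindex (fun q : draw S * T.-tuple (draw S) => [tuple of q.1 :: q.2])) /=.
  under [RHS]eq_bigr do rewrite mulr_sumr.
  rewrite pair_bigA; apply: eq_bigr => -[J h] _ /=.
  by rewrite mulrA.
exists (fun h => (thead h, [tuple of behead h])) => [[J h] _|h _] /=.
  by rewrite theadE; congr pair; apply/val_inj.
by rewrite [RHS]tuple_eta.
Qed.

Lemma eq_Elaw t T X Y : X =1 Y -> Elaw t T X = Elaw t T Y.
Proof. by move=> XY; apply: eq_bigr => h _; rewrite XY. Qed.

End Draws.

(** * Decrease of the potential and expected cost along a run *)

Section Run.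
Context {R : realType}.
Variables (S : setup R) (L : R).
Hypotheses (Sstd : standing L (xstar S)) (batch1 : batch S = 1%N)
  (alpha01 : 0 <= alpha S <= 1)
  (talpha0_ge : xi (alpha S) 1 * alpha_ (alpha S) 1 ^+ 2 <= talpha0 S)
  (eta_gt0 : 0 < Defs.eta S) (eta_le : Defs.eta S <= 1 / (c_par (alpha S) 1 * L + L)).

Local Notation n := (nfun (pb S)).
Local Notation xs := (xstar S).
Local Notation al := (alpha_ (alpha S)).
Local Notation Q := (p_den (alpha S) (talpha0 S)).
Local Notation p t := (p_ (alpha S) 1 (talpha0 S) t).
Local Notation l := (@reg R (pb S)).
Local Notation gap v := (Fval v - Fval xs).

Let xs_oo : finite_reg xs := xstar_finite Sstd.

(** An invariant of [step]: the prox inequality makes the next [z] finite, and the next [y] is a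
    convex combination of that point with [w] and [y]. *)
Definition finite_state (s : state S) := finite_reg (st_y s) /\ finite_reg (st_w s).

(* Here [s] is the state before iteration [t + 1]. *)
Definition potential t (s : state S) : R :=
  Q t * gap (st_w s) + al t ^+ 2 * gap (st_y s)
  + (2 * Defs.eta S)^-1 * enorm (xs - st_z s) ^+ 2.

Let xi_tau t : xi (alpha S) 1 + 1 / al t <= 1 := xi_tau_le1 alpha01 t.

Lemma step_finite t s J : finite_state s -> finite_state (step t s J).
Proof.
case: s => x y z w [/= yoo woo]; split => /=; last by case: J.2.
have /andP[x0 _] := xi_itv (alpha S).
rewrite batch1; set x' := _ + _ *: y; set g := _ *: _ + _.
have al1 := alpha_gt1 alpha01 t.
exact: (mirror_step_finite Sstd al1 x0 (xi_tau t) (erefl x') yoo woo xs_oo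
  (prox_obj_argmin Sstd z eta_gt0 al1 g)).
Qed.

Lemma step_svrg t x y z w j b :
  let x' := tau_ (alpha S) t *: z + xi (alpha S) 1 *: w
    + (1 - xi (alpha S) 1 - tau_ (alpha S) t) *: y in
  let z' := argmin (fun v => ((1 / (2 * al t * Defs.eta S) * enorm (v - z) ^+ 2
    + dotp (svrg x' w j) v)%:E + l v)%E) in
  step t (State x y z w) ([set j]%SET, b) =
  State x' (x' + tau_ (alpha S) t *: (z' - z)) z' (if b then y else w).
Proof. by rewrite /step batch1 /= big_set1 invr1 scale1r. Qed.

(** The new checkpoint is the old [y] with probability [p]. After [mean_mirror_step], the identity
    [p_denE] turns the coefficient of [gap w] into [Q t] and that of [gap y] into [al t ^+ 2]. *)
Lemma step_potential t s : finite_state s ->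
  \sum_J law_draw t.+1 J * potential t.+1 (step t.+1 s J) <= potential t s.
Proof.
case: s => x y z w [/= yoo woo].
rewrite sum_draw//; cbv beta.
pose x' := tau_ (alpha S) t.+1 *: z + xi (alpha S) 1 *: w
  + (1 - xi (alpha S) 1 - tau_ (alpha S) t.+1) *: y.
pose zp j := argmin (fun v => ((1 / (2 * al t.+1 * Defs.eta S) * enorm (v - z) ^+ 2
    + dotp (svrg x' w j) v)%:E + l v)%E).
have zmin j := prox_obj_argmin Sstd z eta_gt0 (alpha_gt1 alpha01 t.+1) (svrg x' w j).
have c3 := c_par_ge3 (alpha S).
have c0 : 0 < c_par (alpha S) 1 by lra.
have xiE : xi (alpha S) 1 = 1 / c_par (alpha S) 1 by rewrite /xi !mul1r.
have := mean_mirror_step Sstd c0 eta_gt0 eta_le (alpha_gt1 alpha01 t.+1) xiE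
  (xi_tau t.+1) (erefl _) yoo woo xs_oo zmin.
rewrite -/(tau_ (alpha S) t.+1) -/x' => H.
pose G j := al t.+1 ^+ 2 * gap (x' + tau_ (alpha S) t.+1 *: (zp j - z))
   + (2 * Defs.eta S)^-1 * enorm (xs - zp j) ^+ 2.
have potE j b : potential t.+1 (step t.+1 (State x y z w) ([set j]%SET, b)) =
    Q t.+1 * gap (if b then y else w) + G j.
  by rewrite (step_svrg t.+1 x y z w j b) /potential -addrA.
pose C := p t.+1 * Q t.+1 * gap y + (Q t.+1 - p t.+1 * Q t.+1) * gap w.
rewrite (eq_bigr (fun j => C + G j)); last first.
  move=> j _; rewrite (potE j true) (potE j false) /C.
  by move: (G j) (gap y) (gap w) (p _) (Q _) => g gy gw pt Qt; ring.
rewrite avgD (avg_const Sstd); apply: (le_trans (lerD (lexx C) H)).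
rewrite /C p_denE// p_denS /potential /=.
move: (gap y) (gap w) (enorm (xs - z) ^+ 2) => gy gw d.
move: (al t) (al t.+1) (Q t) (2 * _)^-1 => a a' q k.
by rewrite le_eqVlt; apply/orP; left; apply/eqP; ring.
Qed.

Lemma law_draw_ge0 t J : 0 <= law_draw (S := S) t.+1 J.
Proof.
have /andP[p0 p1] := p_itv alpha01 talpha0_ge t.
rewrite /law_draw batch1 mulr_ge0//; first by case: ifP => _; rewrite ?invr_ge0.
by case: ifP => _; rewrite ?subr_ge0.
Qed.

Lemma run_finite t s h : finite_state s -> finite_state (run t s h).
Proof. by elim: h t s => //= J h IH t s sfin; apply/IH/step_finite. Qed.

Lemma Elaw_potential T t s : finite_state s ->
  Elaw t.+1 T (fun h => potential (t + T) (run t.+1 s h)) <= potential t s.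
Proof.
elim: T t s => [|T IH] t s sfin; first by rewrite Elaw0 addn0.
rewrite ElawS; apply: le_trans (step_potential t sfin); apply: ler_sum => J _.
apply: ler_wpM2l; first exact: law_draw_ge0.
by rewrite -addSnnS; apply/IH/step_finite.
Qed.

Definition draw_calls (J : draw S) : nat := 2 * #|J.1| + (if J.2 then n else 0).

(** The offset [k] absorbs the cost of the first draw in the induction; it is finally set to [n],
    the initial full gradient. *)
Lemma Elaw_calls T t k :
  Elaw (S := S) t.+1 T (fun h => (k + \sum_(J <- h) draw_calls J)%:R) =
  k%:R + \sum_(i < T) (2 + n%:R * p (t + i).+1).
Proof.
elim: T t k => [|T IH] t k; first by rewrite Elaw0 big_nil addn0 big_ord0 addr0.
rewrite ElawS.
have E (J : draw S) : Elaw t.+2 T (fun h => (k + \sum_(J <- J :: h) draw_calls J)%:R)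
    = (k + draw_calls J)%:R + \sum_(i < T) (2 + n%:R * p (t.+1 + i).+1).
  by rewrite -IH; apply: eq_Elaw => h; rewrite big_cons addnA.
under eq_bigr do rewrite E.
rewrite sum_draw// big_ord_recl.
under [in RHS]eq_bigr do rewrite lift0 -addSnnS.
set s := \sum_(i < T) _.
rewrite -[RHS](avg_const Sstd); congr (_ * _); apply: eq_bigr => j _.
rewrite /draw_calls /= cards1 muln1 addn0 addn0 !natrD.
by move: (k%:R : R) (n%:R : R) (p t.+1) s => *; ring.
Qed.

Lemma law_ge0 t h : 0 <= law (S := S) t.+1 h.
Proof. by elim: h t => //= J h IH t; rewrite mulr_ge0 ?law_draw_ge0. Qed.

Hypothesis init_finite : finite_reg (Defs.init S).

Lemma init_state_finite : finite_state (init_state S).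
Proof. by []. Qed.

Lemma checkpoint_finite h : finite_reg (checkpoint (S := S) h).
Proof. by have [] := run_finite 1 h init_state_finite. Qed.

Lemma expectE T (X : seq (draw S) -> \bar R) (Y : seq (draw S) -> R) :
  (forall h, X h = (Y h)%:E) -> expect T X = (Elaw 1 T Y)%:E.
Proof.
by move=> XY; rewrite /expect -sumEFin; apply: eq_bigr => h _; rewrite XY EFinM.
Qed.

(** The other two terms of the potential are nonnegative and are dropped. *)
Lemma expected_gap T :
  Q T * Elaw 1 T (fun h => gap (checkpoint (S := S) h)) <= potential 0 (init_state S).
Proof.
apply: le_trans (Elaw_potential T 0 init_state_finite).
rewrite mulr_sumr; apply: ler_sum => h _; rewrite mulrCA.
apply: ler_wpM2l; first exact: law_ge0.
have [yoo woo] := run_finite 1 h init_state_finite.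
rewrite /checkpoint /potential add0n -[leRHS]addrA lerDl addr_ge0// mulr_ge0 ?sqr_ge0//.
  by rewrite subr_ge0 (Fval_xstar_le Sstd).
by rewrite invr_ge0 mulr_ge0// ltW.
Qed.

Lemma ifo_complexity_le T : potential 0 (init_state S) <= eps S * Q T.+1 ->
  (ifo_complexity S <= (n%:R + \sum_(i < T.+1) (2 + n%:R * p i.+1))%:E)%E.
Proof.
move=> HT; apply: ereal_inf_lbound; exists T.+1.
  rewrite /= /accurate (@expectE T.+1 _ (fun h => gap (checkpoint (S := S) h))); last first.
    move=> h; rewrite !(objective_fineK Sstd) ?EFinB//; exact: checkpoint_finite.
  rewrite lee_fin; have Q0 := p_den_gt0 alpha01 talpha0_ge T.
  by rewrite -(ler_pM2l Q0) [leRHS]mulrC; apply: le_trans (expected_gap _) HT.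
rewrite (@expectE T.+1 _ (fun h => (ifo_calls (S := S) h)%:R))//.
by rewrite -(Elaw_calls T.+1 0 n).
Qed.

End Run.

(** * Oracle complexity *)

Section Range.
Context {R : realType}.
Variables (n : nat) (e : R).
Hypotheses (n_gt0 : (0 < n)%N) (e01 : 0 < e < 1).
Local Notation ell := (ln (1 / e)).

Lemma ln_inv_gt0 : 0 < ell.
Proof. by have /andP[e0 e1] := e01; rewrite ln_gt0// ltr_pdivlMr// mul1r. Qed.

Lemma ln_nat_ge0 : 0 <= ln (n%:R : R).
Proof. by rewrite ln_ge0// ler1n. Qed.

(** Logarithm of [(1/e)^(1/(1+a)) <= C1 sqrt n / sqrt e]. With [N] and [k] as below,
    [1 + Delta1 = 2 / (1 + N + 2 k)]. *)
Lemma Delta1_le_powR (C1 a : R) : 1 <= C1 -> 0 <= a ->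
  Delta1 n e C1 <= a -> ell / (1 + a) <= ell / 2 + ln n%:R / 2 + ln C1.
Proof.
move=> C11 a0; rewrite /Delta1; have l0 := ln_inv_gt0; have n0 := ln_nat_ge0.
have c0 : 0 <= ln C1 by rewrite ln_ge0.
set N := ln n%:R / ell; set k := ln C1 / ell.
have N0 : 0 <= N by rewrite divr_ge0// ltW.
have k0 : 0 <= k by rewrite divr_ge0// ltW.
rewrite ler_pdivrMr; last lra.
move=> H; have a1 : 0 < 1 + a by lra.
rewrite ler_pdivrMr//.
have -> : ln C1 = k * ell by rewrite divfK ?gt_eqF.
have -> : ln n%:R = N * ell by rewrite divfK ?gt_eqF.
have -> : (ell / 2 + N * ell / 2 + k * ell) * (1 + a) =
  ell * ((1 + N + 2 * k) * (1 + a) / 2) by field.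
rewrite ler_peMr ?(ltW l0)//; lra.
Qed.

(** Numerator and denominator of [Delta2] sum to 2, so a nonpositive denominator would force a
    nonpositive quotient, including the case of division by 0. *)
Lemma Delta2_den_gt0 (C2 : R) : 1 <= C2 -> 0 < Delta2 n e C2 ->
  0 < 1 + ln n%:R / ell - 2 * (ln C2 / ell).
Proof.
move=> C21; rewrite /Delta2; set m := ln n%:R / ell; set k := ln C2 / ell.
move=> D0; rewrite ltNge; apply/negP => m0.
suff : (1 - m + 2 * k) / (1 + m - 2 * k) <= 0 by lra.
by rewrite mulr_ge0_le0 ?invr_le0//; lra.
Qed.

(** Logarithm of [n (1/e)^(a/(1+a)) <= C2 sqrt n / sqrt e], from
    [1 + Delta2 = 2 / (1 + N - 2 k)]. *)
Lemma le_Delta2_powR (C2 a : R) : 1 <= C2 -> 0 <= a -> 0 < Delta2 n e C2 ->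
  a <= Delta2 n e C2 ->
  ln n%:R + ell * a / (1 + a) <= ell / 2 + ln n%:R / 2 + ln C2.
Proof.
move=> C21 a0 D0; have := Delta2_den_gt0 C21 D0; rewrite /Delta2; have l0 := ln_inv_gt0.
set N := ln n%:R / ell; set k := ln C2 / ell => m0.
rewrite ler_pdivlMr// => H; have a1 : 0 < 1 + a by lra.
have -> : ln C2 = k * ell by rewrite divfK ?gt_eqF.
have -> : ln n%:R = N * ell by rewrite divfK ?gt_eqF.
rewrite -(ler_pM2r a1).
have -> : (N * ell + ell * a / (1 + a)) * (1 + a) = ell * (N * (1 + a) + a).
  by field; rewrite gt_eqF.
have -> : (ell / 2 + N * ell / 2 + k * ell) * (1 + a) =
  ell * ((1 + N + 2 * k) * (1 + a) / 2) by field.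
by rewrite ler_pM2l//; lra.
Qed.

Lemma Delta2_gt0_near1 : n%:R < 1 / e ->
  exists2 C, 1 < C & forall C2, 1 <= C2 <= C -> 0 < Delta2 n e C2.
Proof.
move=> ne; have l0 := ln_inv_gt0; have n0 := ln_nat_ge0.
(* The witness is [(1/e)^(1/4)]: it keeps [ln C2 / ell <= 1/4], so the denominator is at least
   1/2. *)
exists (expR (ell / 4)); first by rewrite expR_gt1 divr_gt0.
move=> C2 /andP[C21 C2le]; have C20 : 0 < C2 by lra.
have c0 : 0 <= ln C2 by rewrite ln_ge0.
have cl : ln C2 <= ell / 4 by rewrite -[leRHS]expRK ler_ln ?posrE ?expR_gt0.
have /andP[e0 _] := e01.
have nl : ln n%:R < ell by rewrite ltr_ln ?posrE ?ltr0n ?divr_gt0.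
have N1 : ln n%:R / ell < 1 by rewrite ltr_pdivrMr// [ltRHS]mul1r.
have N0 : 0 <= ln n%:R / ell by rewrite divr_ge0// ltW.
have k1 : ln C2 / ell <= 1 / 4 by rewrite ler_pdivrMr//; lra.
have k0 : 0 <= ln C2 / ell by rewrite divr_ge0// ltW.
by rewrite /Delta2 divr_gt0//; lra.
Qed.

(** Both are values of the decreasing function [(1 - s) / (1 + s)], at [s = N + 2 k] and at
    [s = N - 2 k']. *)
Lemma Delta1_le_Delta2 (C1 C2 : R) : 1 <= C1 -> 1 <= C2 -> 0 < Delta2 n e C2 ->
  Delta1 n e C1 <= Num.min 1 (Delta2 n e C2).
Proof.
move=> C11 C21 D0; have := Delta2_den_gt0 C21 D0; rewrite /Delta1 /Delta2.
have l0 := ln_inv_gt0; have n0 := ln_nat_ge0.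
have k1 : 0 <= ln C1 / ell by rewrite divr_ge0 ?(ltW l0)// ln_ge0.
have k2 : 0 <= ln C2 / ell by rewrite divr_ge0 ?(ltW l0)// ln_ge0.
have N0 : 0 <= ln n%:R / ell by rewrite divr_ge0// ltW.
set N := ln n%:R / ell in N0 *; set k := ln C1 / ell in k1 *.
set k' := ln C2 / ell in k2 * => m0.
have m1 : 0 < 1 + N + 2 * k by lra.
rewrite le_min; apply/andP; split; first by rewrite ler_pdivrMr//; lra.
by rewrite ler_pdivrMr// mulrAC ler_pdivlMr//; nra.
Qed.

(** The right endpoint of the prescribed interval works in both branches. *)
Lemma alpha_range_nonempty (C1 C2 : R) : 1 <= C1 -> 1 <= C2 -> 0 < Delta2 n e C2 ->
  exists a, alpha_range n e C1 C2 a.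
Proof.
move=> C11 C21 D0; have := Delta1_le_Delta2 C11 C21 D0.
rewrite le_min => /andP[D11 D12].
have cut10 : (alpha_cut n e <= (1 / 10)%:E)%E by rewrite /alpha_cut ge_min lexx orbT.
have [D2|D2] := boolP ((Delta2 n e C2)%:E <= alpha_cut n e)%E.
  exists (Delta2 n e C2); rewrite /alpha_range D2; split; last first.
    by rewrite ge_max D12 lexx (ltW D0).
  by have := le_trans D2 cut10; rewrite lee_fin; lra.
exists (Num.min 1 (Delta2 n e C2)); rewrite /alpha_range (negbTE D2) lexx andbT.
split; first by rewrite le_min ge_min lexx (ltW D0) ler01.
rewrite -ltNge in D2; rewrite ge_max; apply/andP; split; last first.
  by rewrite lee_fin le_min D11.
rewrite EFin_min le_min (ltW D2) andbT; apply: le_trans cut10 _.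
by rewrite lee_fin; lra.
Qed.

Lemma alpha_range_itv (C1 C2 a : R) : alpha_range n e C1 C2 a ->
  Delta1 n e C1 <= a <= Delta2 n e C2.
Proof.
rewrite /alpha_range => -[_]; case: ifP => _.
  by rewrite ge_max => /andP[/andP[_ ->] ->].
rewrite ge_max le_min lee_fin => /andP[/andP[_ ->]]; by case/andP.
Qed.

End Range.

(** * Number of iterations and of oracle calls *)

Section Complexity.
Context {R : realType}.

Lemma powR_expR (x r : R) : 0 < x -> x `^ r = expR (r * ln x).
Proof. by move=> x0; rewrite /powR gt_eqF. Qed.

(** Each new term satisfies [u <= - ln (1 - u)], and these logarithms telescope. *)
Lemma harmonic_le_ln (N : nat) : \sum_(i < N.+1) i.+1%:R^-1 <= 1 + ln (N.+1%:R : R).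
Proof.
elim: N => [|N IH]; first by rewrite big_ord_recl big_ord0 ln1 invr1.
rewrite big_ord_recr /=; set u : R := N.+2%:R^-1.
have u0 : 0 < u by rewrite invr_gt0 ltr0n.
have u1 : u < 1 by rewrite invf_lt1 ?ltr0n// ltr1n.
have : ln (1 + (- u)) <= - u by apply: le_ln1Dx; lra.
have -> : 1 + - u = N.+1%:R / N.+2%:R.
  rewrite /u -[N.+2%:R]natr1; have : 0 <= (N.+1%:R : R) by [].
  by move: N.+1%:R => m m0; field; rewrite gt_eqF//; lra.
rewrite ln_div ?posrE ?ltr0n//; move: IH; set s := \sum_(i < _) _.
lra.
Qed.

Variables (S : setup R) (L eta_min talpha_max D gap : R).
Hypotheses (Sadm : admissible S L eta_min talpha_max D gap)
  (batch1 : batch S = 1%N) (eta_min_gt0 : 0 < eta_min).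

Local Notation n := (nfun (pb S)).
Local Notation a := (alpha S).
Local Notation G := (lower_bound S).
Local Notation K := (1 + (talpha_max + 36) * gap + D ^+ 2 / (2 * eta_min)).
Local Notation X := ((1 / eps S) `^ (1 / (1 + a))).

(** The 36 in [K] is [alpha_0^2]; the summand 1 only ensures [K >= 1]. *)
Lemma potential0_le :
  finite_reg (Defs.init S) /\ 0 <= potential 0 (init_state S) <= K - 1.
Proof.
have [Sstd [_ a01] /andP[t0 tM] /andP[e0 _] [_ iD igap]] := Sadm.
have i_oo : finite_reg (Defs.init S).
  move: igap; rewrite /objective (reg_fineK Sstd (xstar_finite Sstd)) /finite_reg.
  by case: (@reg R (pb S) (Defs.init S)) => // r; rewrite ltry.
split=> //; rewrite /potential p_den0 alpha_small//=.
move: igap; rewrite !(objective_fineK Sstd) ?(xstar_finite Sstd)// -EFinB lee_fin.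
have := Fval_xstar_le Sstd i_oo; set u := Fval _; set v := Fval _ => uv vg.
have eta0 := lt_le_trans eta_min_gt0 e0.
have [x0 x1] := andP (xi_itv a).
have t1 : 0 <= talpha0 S.
  by apply: le_trans t0; rewrite batch1 mulr_ge0 ?sqr_ge0// ltW.
have E : enorm (xstar S - Defs.init S) ^+ 2 = enorm (Defs.init S - xstar S) ^+ 2.
  by rewrite !sqr_enorm -opprB dotpNl dotpNr opprK.
have en0 : 0 <= enorm (Defs.init S - xstar S) by exact: sqrtr_ge0.
have iD2 : enorm (Defs.init S - xstar S) ^+ 2 <= D ^+ 2 by nra.
have k0 : 0 <= (2 * Defs.eta S)^-1 by rewrite invr_ge0; lra.
have k1 : (2 * Defs.eta S)^-1 <= (2 * eta_min)^-1.
  by rewrite lef_pV2 ?posrE ?mulr_gt0// ler_pM2l.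
have H3 : (2 * Defs.eta S)^-1 * enorm (xstar S - Defs.init S) ^+ 2
    <= D ^+ 2 / (2 * eta_min).
  by rewrite E [leRHS]mulrC ler_pM// sqr_ge0.
have H4 : 0 <= (2 * Defs.eta S)^-1 * enorm (xstar S - Defs.init S) ^+ 2.
  by rewrite mulr_ge0// sqr_ge0.
move: H3 H4; set d := _ * _ ^+ 2; set d' := D ^+ 2 / _ => H3 H4.
by apply/andP; split; nra.
Qed.

(** The logarithmic bounds come from [ln 2 >= 1/2] and [1 / eps <= G^2]; they let constants and
    [ln (1 / eps)] be absorbed into [ln G]. *)
Lemma lower_bound_ge :
  [/\ n%:R <= G, Num.sqrt n%:R / Num.sqrt (eps S) <= G, 2 <= G &
      1 <= 2 * ln G /\ ln (1 / eps S) <= 2 * ln G].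
Proof.
have [Sstd _ _ _ [/andP[e0 e1] _ _]] := Sadm.
have n1 : (1 : R) <= n%:R by rewrite ler1n; exact: nfun_gt0 Sstd.
have sn1 : 1 <= Num.sqrt (n%:R : R) by rewrite -[leLHS]sqrtr1 ler_wsqrtr.
have se0 : 0 < Num.sqrt (eps S) by rewrite sqrtr_gt0.
have se1 : Num.sqrt (eps S) <= 1 by rewrite -[leRHS]sqrtr1 ler_wsqrtr// ltW.
have q1 : (Num.sqrt (eps S))^-1 <= Num.sqrt n%:R / Num.sqrt (eps S).
  by rewrite ler_peMl// invr_ge0 ltW.
have q2 : 1 <= (Num.sqrt (eps S))^-1 by rewrite invf_ge1.
have G2 : 2 <= G by rewrite /lower_bound; lra.
split=> //.
- by rewrite /lower_bound; lra.
- by rewrite /lower_bound; lra.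
have G0 : 0 < G by lra.
split.
  have : ln (1 + (- (1 / 2) : R)) <= - (1 / 2) by apply: le_ln1Dx; lra.
  have -> : 1 + (- (1 / 2)) = 2^-1 :> R by field.
  rewrite lnV ?posrE//; have : ln 2 <= ln G by rewrite ler_ln ?posrE.
  by lra.
rewrite mulr_natl -lnXn// ler_ln ?posrE ?exprn_gt0// ?divr_gt0//.
have -> : 1 / eps S = (Num.sqrt (eps S))^-1 ^+ 2.
  by rewrite exprVn sqr_sqrtr ?ltW// div1r.
by apply: lerXn2r; rewrite ?nnegrE; rewrite /lower_bound in G2 *; lra.
Qed.

Definition complexity_const (k M : R) : R :=
  2 + 124 * k * M + 200 * 200 * (31 * k * M * (4 + 2 * ln (31 * k))).

Lemma ifo_complexity_near_optimal (M : R) :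
  1 <= M -> X <= M * G -> n%:R * X `^ a <= M * G ->
  (ifo_complexity S <= (complexity_const K M * (G * ln G))%:E)%E.
Proof.
move=> M1 XG nXG.
have [i_oo /andP[pot0 potK]] := potential0_le.
have [Gn _ G2 [lG1 lGe]] := lower_bound_ge.
have [Sstd [_ a01] /andP[t0 tM] /andP[eta0 eta1] [/andP[e0 e1] _ _]] := Sadm.
rewrite batch1 in t0 eta1.
have eta_gt0 := lt_le_trans eta_min_gt0 eta0.
have [a0 a1] := andP a01.
have k1 : 1 <= K by lra.
move: potK k1; set k := K; clearbody k => potK k1.
have ie1 : 1 <= 1 / eps S by rewrite ler_pdivlMr// mul1r ltW.
have ie0 : 0 < 1 / eps S by lra.
have r0 : 0 <= 1 / (1 + a) by rewrite divr_ge0//; lra.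
have r1 : 1 / (1 + a) <= 1 by rewrite ler_pdivrMr//; lra.
have X1 : 1 <= X by rewrite -[leLHS](powRr0 (1 / eps S)); apply: ler_powR.
have k31 : 1 <= 31 * k by lra.
have k31_ge0 : 0 <= 31 * k by lra.
have X_ge0 : 0 <= X := powR_ge0 _ _.
(* Solves [Y^(1 + a) / 30 = k / eps], so by [p_den_growth] any larger number of iterations is
   accurate. *)
set Y := (30 * k / eps S) `^ (1 / (1 + a)).
have Y0 : 0 <= Y := powR_ge0 _ _.
pose T := Num.truncn Y; have YT : Y < T.+1%:R := truncnS_gt Y.
(* Since [30 k >= 1], its root of order [1 + a] is at most [30 k]; rounding up costs at most
   [1 <= k X]. *)
have TY : T.+1%:R <= 31 * k * X.
  have YX : Y <= 30 * k * X.
    rewrite /Y -[in leLHS](div1r (eps S)) powRM; [|lra|exact: ltW].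
    by apply: ler_wpM2r; [exact: powR_ge0 | apply: ler1_powR => //; lra].
  have : T%:R <= Y by rewrite truncn_le.
  by rewrite -natr1; nra.
have TQ : k <= eps S * p_den a (talpha0 S) T.+1.
  apply: (@le_trans _ _ (eps S * (T.+1%:R * T.+1%:R `^ a / 30))); last first.
    by apply: ler_wpM2l; [exact: ltW | exact: p_den_growth].
  have -> : T.+1%:R * T.+1%:R `^ a = T.+1%:R `^ (1 + a) :> R.
    by rewrite powRD ?pnatr_eq0 ?implybT// powRr1.
  have : Y `^ (1 + a) <= T.+1%:R `^ (1 + a).
    by apply: ge0_ler_powR; rewrite ?nnegrE//; [lra | exact: ltW].
  rewrite /Y -powRrM divfK; last by rewrite gt_eqF//; lra.
  rewrite powRr1; last by rewrite divr_ge0 ?(ltW e0)//; lra.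
  rewrite ler_pdivrMr// => H; have : 0 < eps S := e0.
  by set q := _ `^ _ in H *; nra.
apply: le_trans (ifo_complexity_le Sstd batch1 a01 t0 eta_gt0 eta1 i_oo (T := T) _) _.
  by apply: le_trans potK _; lra.
rewrite lee_fin.
have n0 : 0 <= (n%:R : R) by [].
have TX : T.+1%:R `^ a <= 31 * k * X `^ a.
  apply: (@le_trans _ _ ((31 * k * X) `^ a)).
    apply: ge0_ler_powR; rewrite ?nnegrE//; exact: mulr_ge0 k31_ge0 X_ge0.
  rewrite (powRM _ k31_ge0 X_ge0).
  by apply: ler_wpM2r; [exact: powR_ge0 | apply: ler1_powR => //; lra].
(* Bounding [i^a] by [T.+1^a] in [p_le] leaves a harmonic sum, the source of the logarithmic
   factor. *)
have p_sum : \sum_(i < T.+1) (2 + n%:R * p_ a 1 (talpha0 S) i.+1) <=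
    2 * T.+1%:R + 200 * 200 * (n%:R * T.+1%:R `^ a * (1 + ln T.+1%:R)).
  rewrite big_split /= sumr_const card_ord -[2 *+ _]mulr_natr lerD2l.
  apply: (@le_trans _ _ (\sum_(i < T.+1) 200 * 200 * (n%:R * T.+1%:R `^ a) * i.+1%:R^-1)).
    apply: ler_sum => i _.
    have := p_le a01 t0 i; set q := p_ _ _ _ _ => Hq.
    have iT : i.+1%:R `^ a <= T.+1%:R `^ a :> R.
      by apply: ge0_ler_powR; rewrite ?nnegrE ?ler_nat.
    have {}Hq : q <= 200 * 200 * (T.+1%:R `^ a / i.+1%:R).
      apply: le_trans Hq _; apply: ler_wpM2l; first by lra.
      by apply: ler_wpM2r => //; rewrite invr_ge0.
    have -> : 200 * 200 * (n%:R * T.+1%:R `^ a) / i.+1%:R =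
      n%:R * (200 * 200 * (T.+1%:R `^ a / i.+1%:R)) :> R by ring.
    by apply: ler_wpM2l.
  rewrite -mulr_sumr [leRHS]mulrA; apply: ler_wpM2l; last exact: harmonic_le_ln.
  apply: mulr_ge0; first by lra.
  exact: mulr_ge0 n0 (powR_ge0 _ _).
have k0 : 0 <= ln (31 * k) := ln_ge0 k31.
have lT : 1 + ln T.+1%:R <= (4 + 2 * ln (31 * k)) * ln G.
  have : ln T.+1%:R <= ln (31 * k * X) :> R.
    by rewrite ler_ln ?posrE// (lt_le_trans ltr01)// mulr_ege1.
  rewrite lnM ?posrE ?(lt_le_trans ltr01)// ln_powR.
  have : 1 / (1 + a) * ln (1 / eps S) <= ln (1 / eps S).
    by rewrite ler_piMl// ln_ge0.
  by nra.
apply: le_trans (lerD (lexx _) p_sum) _.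
have X0 : 0 <= X `^ a := powR_ge0 _ _.
have nT : n%:R * T.+1%:R `^ a <= 31 * k * (M * G).
  apply: (@le_trans _ _ (31 * k * (n%:R * X `^ a))); last exact: ler_wpM2l.
  by rewrite mulrCA; apply: ler_wpM2l.
have H1 : n%:R * T.+1%:R `^ a * (1 + ln T.+1%:R) <=
    31 * k * (M * G) * ((4 + 2 * ln (31 * k)) * ln G).
  apply: (ler_pM _ _ nT lT); first by rewrite mulr_ge0// powR_ge0.
  by rewrite addr_ge0// ln_ge0// ler1n.
have H2 : T.+1%:R <= 31 * k * (M * G).
  exact: le_trans TY (ler_wpM2l k31_ge0 XG).
have G_ge0 : 0 <= G := le_trans n0 Gn.
have H3 : G <= 2 * (G * ln G) by rewrite mulrCA (ler_peMr G_ge0 lG1).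
have kM : 0 <= k * M := mulr_ge0 (le_trans ler01 k1) (le_trans ler01 M1).
have H4 : k * M * G <= k * M * (2 * (G * ln G)) by apply: ler_wpM2l.
have -> : complexity_const k M * (G * ln G) = 2 * (G * ln G)
  + 62 * (k * M * (2 * (G * ln G)))
  + 200 * 200 * (31 * k * (M * G) * ((4 + 2 * ln (31 * k)) * ln G)).
  by rewrite /complexity_const; ring.
move: H1 H2 H3 H4; set h := n%:R * _ * _; set h' := _ * (_ * ln G).
by move=> *; lra.
Qed.

End Complexity.

(** * The regimes [n < 1 / eps] and [n >= 1 / eps] *)

Section Cases.
Context {R : realType}.
Variables (L eta_min talpha_max D gap C1 C2 : R).
Hypotheses (eta_min_gt0 : 0 < eta_min) (C1_ge1 : 1 <= C1) (C2_ge1 : 1 <= C2).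
Local Notation setups :=
  [set S : setup R | admissible S L eta_min talpha_max D gap].
Local Notation K := (1 + (talpha_max + 36) * gap + D ^+ 2 / (2 * eta_min)).

Lemma sqrt_ratio_expR (n : nat) (e : R) : (0 < n)%N -> 0 < e ->
  Num.sqrt n%:R / Num.sqrt e = expR (ln (1 / e) / 2 + ln n%:R / 2).
Proof.
move=> n0 e0; have sE (x : R) : 0 < x -> Num.sqrt x = expR (ln x / 2).
  by move=> x0; rewrite -powR12_sqrt ?(ltW x0)// powR_expR// mulrC.
rewrite !sE ?ltr0n// -expRN -expRD div1r lnV ?posrE//.
by congr expR; rewrite addrC mulNr.
Qed.

(** Exponentiates the two range conditions, which give factors [C1] and [C2]; as both are at least
    1, their product serves for both bounds. *)
Lemma case_i_bounds S : setups S -> case_i C1 C2 S ->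
  (1 / eps S) `^ (1 / (1 + alpha S)) <= C1 * C2 * lower_bound S /\
  (nfun (pb S))%:R * ((1 / eps S) `^ (1 / (1 + alpha S))) `^ alpha S
    <= C1 * C2 * lower_bound S.
Proof.
move=> Sadm [ne b1 D0 ar].
have [Sstd [_ /andP[a0 a1]] _ _ [e01 _ _]] := Sadm.
have n0 := nfun_gt0 Sstd.
have [_ G1 G2 _] := lower_bound_ge Sadm.
have /andP[e0 e1] := e01.
have /andP[D1 D2] := alpha_range_itv ar.
have ie0 : 0 < 1 / eps S by rewrite divr_gt0.
set X := _ `^ (1 / _).
have XE : X = expR (ln (1 / eps S) / (1 + alpha S)).
  by rewrite /X powR_expR// div1r mulrC.
have G0 : 0 <= lower_bound S by lra.
have sG (c : R) : 1 <= c -> expR (ln (1 / eps S) / 2 + ln (nfun (pb S))%:R / 2 + ln c)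
    <= c * lower_bound S.
  move=> c1; have c0 : 0 < c by lra.
  by rewrite expRD -sqrt_ratio_expR// lnK ?posrE// mulrC ler_pM2l.
have C10 : 0 <= C1 by apply: le_trans C1_ge1.
have C20 : 0 <= C2 by apply: le_trans C2_ge1.
split.
  apply: (@le_trans _ _ (C1 * lower_bound S)); last first.
    by apply: ler_wpM2r => //; rewrite ler_peMr.
  by apply: le_trans (sG _ C1_ge1); rewrite XE ler_expR Delta1_le_powR.
apply: (@le_trans _ _ (C2 * lower_bound S)); last first.
  by apply: ler_wpM2r => //; rewrite ler_peMl.
apply: le_trans (sG _ C2_ge1).
rewrite -[X in X * _]lnK ?posrE ?ltr0n// XE -expRM -expRD ler_expR.
by rewrite mulrAC le_Delta2_powR.
Qed.

(** With exponent 0 the quantities are [1 / eps] and [n], both at most [n] in this regime. *)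
Lemma case_ii_bounds S : setups S -> case_ii S ->
  (1 / eps S) `^ (1 / (1 + alpha S)) <= C1 * C2 * lower_bound S /\
  (nfun (pb S))%:R * ((1 / eps S) `^ (1 / (1 + alpha S))) `^ alpha S
    <= C1 * C2 * lower_bound S.
Proof.
move=> Sadm [ne b1 aE].
have [_ _ _ _ [/andP[e0 _] _ _]] := Sadm.
have [G1 _ G2 _] := lower_bound_ge Sadm.
have {}ne : 1 / eps S <= (nfun (pb S))%:R by rewrite leNgt; apply/negP.
have nG : (nfun (pb S))%:R <= C1 * C2 * lower_bound S.
  apply: le_trans G1 _; rewrite ler_peMl//; first by lra.
  by rewrite -[leLHS]mulr1 ler_pM.
rewrite aE addr0 divr1 powRr1 ?divr_ge0 ?(ltW e0)// powRr0 mulr1; split=> //.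
exact: le_trans ne nG.
Qed.

Lemma near_optimal_cases S : setups S -> case_i C1 C2 S \/ case_ii S ->
  (ifo_complexity S <=
    (complexity_const K (C1 * C2) * (lower_bound S * ln (lower_bound S)))%:E)%E.
Proof.
move=> Sadm cases.
have b1 : batch S = 1%N by case: cases => [[]|[]].
have CC1 : 1 <= C1 * C2 by rewrite -[leLHS]mulr1 ler_pM.
have [XG nXG] : _ /\ _ := match cases with
  | or_introl h => case_i_bounds Sadm h | or_intror h => case_ii_bounds Sadm h end.
exact: (ifo_complexity_near_optimal Sadm b1 eta_min_gt0 CC1 XG nXG).
Qed.

(** From [1 / eps <= n] follows [G <= 2 n], and [n >= 2] gives [2 n <= n^2], so [ln G <= 2 ln n]. *)
Lemma case_ii_lower_bound S : setups S -> case_ii S ->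
  lower_bound S * ln (lower_bound S)
    <= 4 * ((nfun (pb S))%:R * ln (nfun (pb S))%:R).
Proof.
move=> Sadm [ne b1 aE].
have [Sstd _ _ _ [/andP[e0 e1] _ _]] := Sadm.
have [_ _ G2 _] := lower_bound_ge Sadm.
have {}ne : (eps S)^-1 <= (nfun (pb S))%:R by rewrite -div1r leNgt; apply/negP.
have n2 : (2 : R) <= (nfun (pb S))%:R.
  by rewrite ler_nat -(ltr_nat R); apply: lt_le_trans ne; rewrite invf_gt1.
have Gn : lower_bound S <= 2 * (nfun (pb S))%:R.
  rewrite /lower_bound mulr_natl mulr2n lerD2l -sqrtrV; last by apply: ltW.
  rewrite -sqrtrM// -[leRHS]ger0_norm// -sqrtr_sqr ler_wsqrtr//.
  by rewrite expr2 ler_wpM2l.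
move: n2 Gn; move: (nfun (pb S))%:R => m m2 Gm.
have m0 : 0 < m by lra.
have G0 : 0 < lower_bound S by lra.
have lm : ln (lower_bound S) <= 2 * ln m.
  rewrite mulr_natl -lnXn// ler_ln ?posrE ?exprn_gt0//.
  by apply: le_trans Gm _; rewrite expr2 ler_pM2r.
have l0 : 0 <= ln (lower_bound S) by rewrite ln_ge0//; lra.
have -> : 4 * (m * ln m) = (2 * m) * (2 * ln m) by ring.
by apply: ler_pM => //; exact: ltW.
Qed.

End Cases.

Theorem corollary1 (R : realType) :
  (forall (n : nat) (e : R), (0 < n)%N -> 0 < e < 1 -> n%:R < 1 / e ->
     (exists2 C, 1 < C & forall C2, 1 <= C2 <= C -> 0 < Delta2 n e C2) /\
     (forall C1 C2, 1 <= C1 -> 1 <= C2 -> 0 < Delta2 n e C2 ->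
        exists a, alpha_range n e C1 C2 a)) /\
  (forall L eta_min talpha_max D gap C1 C2 : R,
     0 < L -> 0 < eta_min -> 1 <= C1 -> 1 <= C2 ->
     let setups := [set S : setup R | admissible S L eta_min talpha_max D gap] in
     [/\ tildeO (setups `&` [set S | case_i C1 C2 S]) (@ifo_complexity R)
           (fun S => (nfun (pb S))%:R + Num.sqrt (nfun (pb S))%:R / Num.sqrt (eps S)),
         tildeO (setups `&` [set S | case_ii S]) (@ifo_complexity R)
           (fun S => (nfun (pb S))%:R) &
         near_optimal (setups `&` [set S | case_i C1 C2 S \/ case_ii S])]).
Proof.
split=> [n e n0 e01 ne|L eta_min talpha_max D gap C1 C2 _ eta0 C11 C21 setups].
  split=> [|C1 C2 C11 C21 D2]; first exact: Delta2_gt0_near1.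
  exact: alpha_range_nonempty.
have bound := @near_optimal_cases R L eta_min talpha_max D gap C1 C2 eta0 C11 C21.
set C := complexity_const _ _ in bound.
split.
- exists C, 1%N => S [Sadm ci]; rewrite expr1.
  exact: bound Sadm (or_introl ci).
(* The absolute value stands in for the sign of [C], which is not at hand before a setup is
   given. *)
- exists (`|C| * 4), 1%N => S [Sadm cii]; rewrite expr1.
  apply: le_trans (bound _ Sadm (or_intror cii)) _; rewrite lee_fin -mulrA.
  have [_ _ G2 _] := lower_bound_ge Sadm.
  apply: (@le_trans _ _ (`|C| * (lower_bound S * ln (lower_bound S)))).
    apply: ler_wpM2r (ler_norm C); rewrite mulr_ge0 ?ln_ge0//.
      by apply: le_trans G2.
    by apply: le_trans G2; rewrite ler1n.
  by apply: ler_wpM2l (case_ii_lower_bound Sadm cii).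
- by exists C => S [Sadm cases]; exact: bound.
Qed.
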